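(* Let $H$ be a semisimple Hopf algebra over an algebraically closed field $K$ of characteristic zero. Suppose that $p$ is a prime that divides $\dim(H)$. Then $p$ also divides $\exp(H)$.
   Context: A semisimple Hopf algebra is finite-dimensional; let $\varepsilon$ denote its counit. For $h\in H$ and $m\ge 1$, put $h^{[m]} := h_{(1)}h_{(2)}\cdots h_{(m)}$ (Sweedler notation for the iterated coproduct). The exponent $\exp(H)$ is the exponent of the left regular representation, i.e. the smallest natural number $m\ge 1$ such that $h^{[m]}=\varepsilon(h)1$ for all $h\in H$; under the present assumptions such a number exists (Etingof and Gelaki proved that $\exp(H)$ is finite and divides $\dim(H)^3$). *)

(* Defs.v *)
From HB Require Import structures.
From mathcomp Require Import all_boot all_order all_algebra all_field.

Set Implicit Arguments.
Unset Strict Implicit.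
Unset Printing Implicit Defensive.

Import GRing.Theory.
Local Open Scope ring_scope.

Reserved Notation "u ⊗ v" (at level 40, left associativity).

(* The tensor product of two finite-dimensional spaces is modelled by matrices
   of coordinates in the bases [vbasis fullv]; the lemmas [tens_liftE] and
   [tens_hom_ext] are its universal property. *)
Section Tensor.
Variable K : fieldType.

Definition tens (U V : vectType K) : vectType K :=
  'M[K]_(\dim {:U}, \dim {:V}).

Definition tensv (U V : vectType K) (u : U) (v : V) : tens U V :=
  \matrix_(i, j) (coord (vbasis {:U}) i u * coord (vbasis {:V}) j v).

Local Notation "u ⊗ v" := (tensv u v).

(* The linear map with u ⊗ v |-> f u v; meaningful when f is bilinear. *)
Definition tens_lift (U V W : vectType K) (f : U -> V -> W) (x : tens U V) : W :=
  \sum_i \sum_j (x : 'M[K]_(_, _)) i j *: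
    f (vbasis {:U})`_i (vbasis {:V})`_j.

Lemma tens_lift_is_linear (U V W : vectType K) (f : U -> V -> W) :
  linear (tens_lift f).
Proof.
move=> a x y; rewrite /tens_lift scaler_sumr -big_split /=.
apply: eq_bigr => i _; rewrite scaler_sumr -big_split /=.
by apply: eq_bigr => j _; rewrite !mxE scalerDl scalerA.
Qed.

HB.instance Definition _ (U V W : vectType K) (f : U -> V -> W) :=
  GRing.isLinear.Build K (tens U V) W *:%R (tens_lift f)
    (tens_lift_is_linear f).

Lemma tensv_linearl (U V : vectType K) (v : V) :
  linear (fun u : U => u ⊗ v).
Proof.
by move=> a x y; apply/matrixP=> i j; rewrite !mxE linearP mulrDl mulrA.
Qed.

Lemma tensv_linearr (U V : vectType K) (u : U) :
  linear (fun v : V => u ⊗ v).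
Proof.
by move=> a x y; apply/matrixP=> i j; rewrite !mxE linearP mulrDr mulrCA.
Qed.

Lemma tens_liftE (U V W : vectType K) (f : U -> V -> W) (u : U) (v : V) :
  (forall y, linear (f^~ y)) -> (forall x, linear (f x)) ->
  tens_lift f (u ⊗ v) = f u v.
Proof.
move=> fl fr.
pose fL y : {linear U -> W} :=
  HB.pack (f^~ y) (GRing.isLinear.Build K U W *:%R (f^~ y) (fl y)).
pose fR x : {linear V -> W} :=
  HB.pack (f x) (GRing.isLinear.Build K V W *:%R (f x) (fr x)).
rewrite {2}(coord_vbasis (memvf u)) -[RHS]/(fL v _) linear_sum.
apply: eq_bigr => i _; rewrite linearZ /= {2}(coord_vbasis (memvf v)).
rewrite -[f _ _]/(fR _ _) linear_sum scaler_sumr.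
by apply: eq_bigr => j _; rewrite linearZ scalerA mxE.
Qed.

Lemma tens_hom_ext (U V W : vectType K) (f g : {linear tens U V -> W}) :
  (forall u v, f (u ⊗ v) = g (u ⊗ v)) -> f =1 g.
Proof.
move=> fg x; rewrite (matrix_sum_delta x) !linear_sum.
apply: eq_bigr => i _; rewrite !linear_sum; apply: eq_bigr => j _.
rewrite !linearZ /=; congr (_ *: _).
suff -> : delta_mx i j = (vbasis {:U})`_i ⊗ (vbasis {:V})`_j by exact: fg.
have fU := basis_free (vbasisP {:U}); have fV := basis_free (vbasisP {:V}).
apply/matrixP=> k l; rewrite !mxE (coord_free _ _ fU) (coord_free _ _ fV).
rewrite -natrM mulnb; congr (nat_of_bool _)%:R.
by rewrite (eq_sym k) (eq_sym l).
Qed.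

Definition tens_map (U U' V V' : vectType K) (f : U -> U') (g : V -> V') :
  tens U V -> tens U' V' := tens_lift (fun u v => f u ⊗ g v).

Definition tens_assoc (U V W : vectType K) :
    tens (tens U V) W -> tens U (tens V W) :=
  tens_lift (fun x w => tens_lift (fun u v => u ⊗ (v ⊗ w)) x).

Lemma tens_mapE (U U' V V' : vectType K)
    (f : {linear U -> U'}) (g : {linear V -> V'}) (u : U) (v : V) :
  tens_map f g (u ⊗ v) = f u ⊗ g v.
Proof.
rewrite /tens_map tens_liftE // => x a y z; rewrite linearP.
  exact: tensv_linearl.
exact: tensv_linearr.
Qed.

Lemma tens_assocE (U V W : vectType K) (u : U) (v : V) (w : W) :
  tens_assoc ((u ⊗ v) ⊗ w) = u ⊗ (v ⊗ w).
Proof.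
have E y : tens_lift (fun u v => u ⊗ (v ⊗ y)) (u ⊗ v) = u ⊗ (v ⊗ y).
  rewrite tens_liftE // => x; first exact: tensv_linearl.
  by move=> a v1 v2; rewrite tensv_linearl tensv_linearr.
rewrite /tens_assoc tens_liftE ?E // => [y a z t | x a y z].
  exact: linearP.
rewrite -[RHS]/(a *: _ + _) /tens_lift scaler_sumr -big_split /=.
apply: eq_bigr => i _; rewrite scaler_sumr -big_split /=.
apply: eq_bigr => j _; rewrite !tensv_linearr scalerDr !scalerA.
by rewrite (mulrC a).
Qed.

End Tensor.

Notation "u ⊗ v" := (tensv u v) : ring_scope.

Section Hopf.
Variables (K : fieldType) (H : falgType K).

Definition tens_mul (x y : tens H H) : tens H H :=
  @tens_lift K H H (tens H H)
    (fun a b => @tens_lift K H H (tens H H)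
      (fun c d => tensv (U := H) (V := H) (a * c) (b * d)) y) x.

Lemma tens_mulE (a b c d : H) :
  tens_mul (a ⊗ b) (c ⊗ d) = tensv (U := H) (V := H) (a * c) (b * d).
Proof.
have E u v : @tens_lift K H H (tens H H)
    (fun c d => tensv (U := H) (V := H) (u * c) (v * d)) (c ⊗ d)
    = tensv (U := H) (V := H) (u * c) (v * d).
  rewrite tens_liftE // => x k y z; rewrite mulrDr -scalerAr.
    exact: tensv_linearl.
  exact: tensv_linearr.
rewrite /tens_mul tens_liftE ?E // => x k y z; rewrite !E mulrDl -scalerAl.
  exact: tensv_linearl.
exact: tensv_linearr.
Qed.

Record hopf_algebra := HopfAlgebra {
  comul : 'Hom(H, tens H H);
  counit : 'Hom(H, K^o);
  antipode : 'End(H);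
  comulA : forall h : H,
    tens_assoc (tens_map comul idfun (comul h))
    = tens_map idfun comul (comul h);
  counitl : forall h : H, @tens_lift K H H H (fun a b => counit a *: b) (comul h) = h;
  counitr : forall h : H, @tens_lift K H H H (fun a b => counit b *: a) (comul h) = h;
  comulM : forall a b : H, comul (a * b) = tens_mul (comul a) (comul b);
  comul1 : comul 1 = tensv (U := H) (V := H) 1 1;
  counitM : forall a b : H, counit (a * b) = counit a * counit b;
  counit1 : counit 1 = 1;
  antipodel : forall h : H,
    @tens_lift K H H H (fun a b => antipode a * b) (comul h) = counit h *: 1;
  antipoder : forall h : H,
    @tens_lift K H H H (fun a b => a * antipode b) (comul h) = counit h *: 1
}.

(* H tensored with itself n + 1 times *)
Fixpoint tens_pow (n : nat) : vectType K :=
  if n is n'.+1 then tens (tens_pow n') H else H.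

(* h |-> h_(1) ⊗ ... ⊗ h_(n+1) *)
Fixpoint iter_comul (A : hopf_algebra) (n : nat) : H -> tens_pow n :=
  match n return H -> tens_pow n with
  | 0 => idfun
  | n'.+1 => fun h => tens_map (iter_comul A n') idfun (comul A h)
  end.

(* a_1 ⊗ ... ⊗ a_(n+1) |-> a_1 * ... * a_(n+1) *)
Fixpoint iter_mul (n : nat) : tens_pow n -> H :=
  match n return tens_pow n -> H with
  | 0 => idfun
  | n'.+1 => @tens_lift K (tens_pow n') H H (fun x a => iter_mul x * a)
  end.

(* The Sweedler power h^[m]; the value at m = 0 is the usual convention. *)
Definition sweedler_pow (A : hopf_algebra) (m : nat) (h : H) : H :=
  if m is n.+1 then iter_mul (iter_comul A n h) else counit A h *: 1.

Definition sweedler_trivial (A : hopf_algebra) (m : nat) : Prop :=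
  forall h : H, sweedler_pow A m h = counit A h *: 1.

Definition is_hopf_exponent (A : hopf_algebra) (e : nat) : Prop :=
  [/\ (0 < e)%N, sweedler_trivial A e
    & forall m : nat, (0 < m)%N -> sweedler_trivial A m -> (e <= m)%N].

End Hopf.

Section Semisimple.
Variables (K : fieldType) (H : falgType K).

Definition left_ideal (I : {vspace H}) : Prop :=
  forall a x : H, x \in I -> a * x \in I.

Definition minimal_left_ideal (I : {vspace H}) : Prop :=
  [/\ left_ideal I, I != 0%VS
    & forall J : {vspace H}, left_ideal J -> (J <= I)%VS -> J = 0%VS \/ J = I].

(* The left regular module is a direct sum of simple submodules. *)
Definition semisimple_algebra : Prop :=
  exists (n : nat) (I : 'I_n -> {vspace H}),
    [/\ forall i, minimal_left_ideal (I i), directv (\sum_i I i)%VS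
      & (\sum_i I i)%VS = fullv].

End Semisimple.

(* Main.v *)
(* Let N = dim H and let S be the antipode.  If p does not divide e, choose a
   power m > 1 of p with m = 1 modulo e, so that the m-th convolution power of S
   is S.  With L the two-sided integral with counit 1, consider on the m-th
   tensor power of H the operator T which multiplies on the right by the m-fold
   coproduct of L and then maps a_1 ⊗ ... ⊗ a_m to a_2 ⊗ ... ⊗ a_m ⊗ S²(a_1).
   Both the trace of T and that of T^m are computed by means of the integral
   lam(h) = tr(x |-> h S²(x)) of the dual of H:
     tr T = lam(S(L_(1)) ... S(L_(m))) = lam(S(L)) = 1, tr T^m = lam(1)^(m-1).
   As lam(1) = tr S², no knowledge of S² = id is needed: it suffices that
   - S has finite order, because h g = g S^4(h) for the group-like element
     g = lam(L_(1)) L_(2), whose e-th power is its e-th Sweedler power, that is 1;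
     so the eigenvalues of T are zero or roots of unity, and
     1 = (tr T)^m = tr T^m modulo p in the algebraic integers;
   - tr S² is N times an algebraic integer: if x in H is the regular character of
     the dual, then x² = N x, S²(x) = x and lam(x) = lam(1), so tr S² / N is the
     trace of the product of the idempotent x / N with S².
   Thus p divides 1 in the algebraic integers, a contradiction. *)

From HB Require Import structures.
Require Import Defs.
From mathcomp Require Import all_boot all_order all_algebra all_field.
From mathcomp Require Import cyclic ring.

Set Implicit Arguments.
Unset Strict Implicit.
Unset Printing Implicit Defensive.
Import GRing.Theory.
Local Open Scope ring_scope.

Reserved Notation "'\sw_' ( a , b <- h ) E"
  (at level 36, a, b at level 0, h at level 50, E at level 36,
   format "'\sw_' ( a , b  <-  h )  E").

(** * Linearity as a predicate on bare functions, usable on abstractions over Sweedler components *)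

Definition is_lin (K : fieldType) (V W : lmodType K) (f : V -> W) :=
  forall a x y, f (a *: x + y) = a *: f x + f y.

Section Lin.
Variables (K : fieldType).
Implicit Types U V W : lmodType K.

Lemma lin_id V : is_lin (fun x : V => x). Proof. by []. Qed.

Lemma lin_struct V W (f : {linear V -> W}) : is_lin f.
Proof. exact: linearP. Qed.

Lemma lin_comp U V W (f : V -> W) (g : U -> V) :
  is_lin f -> is_lin g -> is_lin (fun x => f (g x)).
Proof. by move=> lf lg a x y; rewrite lg lf. Qed.

Lemma lin_scaler V W c (g : V -> W) : is_lin g -> is_lin (fun x => c *: g x).
Proof. by move=> lg a x y; rewrite lg scalerDr !scalerA mulrC. Qed.

Lemma lin_scalel V W (g : V -> K^o) (w : W) :
  is_lin g -> is_lin (fun x => (g x : K) *: w).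
Proof. by move=> lg a x y; rewrite lg scalerDl scalerA. Qed.

Lemma lin_add V W (f g : V -> W) :
  is_lin f -> is_lin g -> is_lin (fun x => f x + g x).
Proof. by move=> lf lg a x y; rewrite lf lg scalerDr addrACA. Qed.

Lemma lin_sum V W I r (P : pred I) (f : I -> V -> W) :
  (forall i, is_lin (f i)) -> is_lin (fun x => \sum_(i <- r | P i) f i x).
Proof.
move=> lf a x y; rewrite scaler_sumr -big_split; apply: eq_bigr => i _.
exact: lf.
Qed.

Lemma lin_mulr V (B : algType K) (g : V -> B) b :
  is_lin g -> is_lin (fun x => b * g x).
Proof. by move=> lg a x y; rewrite lg mulrDr scalerAr. Qed.

Lemma lin_mull V (B : algType K) (g : V -> B) b :
  is_lin g -> is_lin (fun x => g x * b).
Proof. by move=> lg a x y; rewrite lg mulrDl scalerAl. Qed.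

Definition pack_lin V W (f : V -> W) (lf : is_lin f) : {linear V -> W} :=
  HB.pack f (GRing.isLinear.Build K V W *:%R f lf).

Lemma is_lin_sum V W (f : V -> W) (lf : is_lin f) I r (P : pred I) F :
  f (\sum_(i <- r | P i) F i) = \sum_(i <- r | P i) f (F i).
Proof. exact: (linear_sum (pack_lin lf)). Qed.

Lemma is_linZ V W (f : V -> W) (lf : is_lin f) a x : f (a *: x) = a *: f x.
Proof. exact: (linearZZ (pack_lin lf)). Qed.

Lemma is_lin0 V W (f : V -> W) (lf : is_lin f) : f 0 = 0.
Proof. exact: (linear0 (pack_lin lf)). Qed.

End Lin.

(** * Sweedler calculus *)

Section Sweedler.
Variables (K : fieldType) (H : falgType K) (A : hopf_algebra H).
Implicit Types (V W : vectType K) (h k a b c : H).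

(* sw F h is F h_(1) h_(2), meaningful when F is bilinear. *)
Definition sw W (F : H -> H -> W) h : W := @tens_lift K H H W F (comul A h).

Local Notation Δ := (comul A).
Local Notation ε := (counit A).
Local Notation S := (antipode A).

Definition is_bil (U V : lmodType K) (W : lmodType K) (F : U -> V -> W) :=
  (forall y, is_lin (F^~ y)) /\ (forall x, is_lin (F x)).

Lemma sw_lin W (F : H -> H -> W) : is_lin (sw F).
Proof. by move=> a x y; rewrite /sw !linearP. Qed.

Lemma eq_sw W (F G : H -> H -> W) h :
  (forall a b, F a b = G a b) -> sw F h = sw G h.
Proof.
move=> FG; apply: eq_bigr => i _; apply: eq_bigr => j _; congr (_ *: _).
exact: FG.
Qed.

Lemma sw_map V W (f : V -> W) (F : H -> H -> V) h : is_lin f ->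
  f (sw F h) = sw (fun a b => f (F a b)) h.
Proof.
move=> lf; rewrite /sw /tens_lift (is_lin_sum lf); apply: eq_bigr => i _.
by rewrite (is_lin_sum lf); apply: eq_bigr => j _; rewrite (is_linZ lf).
Qed.

Lemma lin_sw_fun (V : lmodType K) W (F : V -> H -> H -> W) h :
  (forall a b, is_lin (fun x => F x a b)) -> is_lin (fun x => sw (F x) h).
Proof.
move=> lF; rewrite /sw /tens_lift; apply: lin_sum => i; apply: lin_sum => j.
exact/lin_scaler/lF.
Qed.

Lemma sw_swap W (F : H -> H -> H -> H -> W) h k :
  sw (fun a b => sw (fun c d => F a b c d) k) h
  = sw (fun c d => sw (fun a b => F a b c d) h) k.
Proof.
rewrite /sw /tens_lift !pair_bigA /=.
under eq_bigr => p _ do rewrite pair_bigA scaler_sumr.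
rewrite exchange_big; apply: eq_bigr => q _.
rewrite pair_bigA scaler_sumr; apply: eq_bigr => p _.
by rewrite !scalerA mulrC.
Qed.

Lemma tens_lift_comp (U V U' V' W : vectType K) (G : U' -> V' -> W)
    (f : U -> V -> U') (g : U -> V -> V') (x : tens U V) : is_bil G ->
  tens_lift G (tens_lift (fun u v => f u v ⊗ g u v) x)
  = tens_lift (fun u v => G (f u v) (g u v)) x.
Proof.
case=> Gl Gr; rewrite {2}/tens_lift linear_sum; apply: eq_bigr => i _.
rewrite linear_sum; apply: eq_bigr => j _; rewrite linearZ /=.
by rewrite tens_liftE.
Qed.

(** Extend a ⊗ (b ⊗ c) |-> F a b c linearly and apply it to the axiom [comulA]; the two sides unfold
    to the two iterated sums. *)
Lemma sw_assoc W (F : H -> H -> H -> W) h :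
  (forall b c, is_lin (fun a => F a b c)) ->
  (forall a c, is_lin (fun b => F a b c)) ->
  (forall a b, is_lin (fun c => F a b c)) ->
  sw (fun x c => sw (fun a b => F a b c) x) h
  = sw (fun a y => sw (fun b c => F a b c) y) h.
Proof.
move=> F1 F2 F3.
pose L (a : H) (y : tens H H) := tens_lift (F a) y.
have bL : is_bil L.
  split=> [y a u v|a c x y]; last by rewrite /L linearP.
  rewrite /L /tens_lift scaler_sumr -big_split /=; apply: eq_bigr => i _.
  rewrite scaler_sumr -big_split /=; apply: eq_bigr => j _.
  by rewrite F1 scalerDr !scalerA mulrC.
have /(congr1 (fun t => tens_lift L t)) := comulA A h.
rewrite /tens_map [X in _ = X -> _]tens_lift_comp //.
rewrite -[X in _ = X]/(sw (fun a y => sw (fun b c => F a b c) y) h) => <-.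
rewrite /tens_assoc [X in tens_lift L X]tens_lift_comp; last first.
  split=> [w | x] a u v; first by rewrite /= linearP.
  rewrite /tens_lift scaler_sumr -big_split /=; apply: eq_bigr => i _.
  rewrite scaler_sumr -big_split /=; apply: eq_bigr => j _.
  by rewrite !tensv_linearr scalerDr !scalerA mulrC.
rewrite /sw {2}/tens_lift linear_sum; apply: eq_bigr => i _.
rewrite linear_sum; apply: eq_bigr => j _; rewrite linearZ /=; congr (_ *: _).
rewrite tens_lift_comp //; apply: eq_bigr => k _; apply: eq_bigr => l _.
by rewrite /L tens_liftE //; [apply: F2 | apply: F3].
Qed.

Lemma sw_counitl W (M : H -> W) h : is_lin M ->
  sw (fun a b => ε a *: M b) h = M h.
Proof.
move=> lM; rewrite -{2}(counitl A h) -/(sw _ h) sw_map //.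
by apply: eq_sw => a b; rewrite is_linZ.
Qed.

Lemma sw_counitr W (M : H -> W) h : is_lin M ->
  sw (fun a b => ε b *: M a) h = M h.
Proof.
move=> lM; rewrite -{2}(counitr A h) -/(sw _ h) sw_map //.
by apply: eq_sw => a b; rewrite is_linZ.
Qed.

Lemma sw_antipodel W (M : H -> W) h : is_lin M ->
  sw (fun a b => M (S a * b)) h = ε h *: M 1.
Proof. by move=> lM; rewrite -is_linZ // -(antipodel A h) -/(sw _ h) sw_map. Qed.

Lemma sw_antipoder W (M : H -> W) h : is_lin M ->
  sw (fun a b => M (a * S b)) h = ε h *: M 1.
Proof. by move=> lM; rewrite -is_linZ // -(antipoder A h) -/(sw _ h) sw_map. Qed.

Lemma swM W (F : H -> H -> W) h k : is_bil F ->
  sw F (h * k) = sw (fun a b => sw (fun c d => F (a * c) (b * d)) k) h.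
Proof.
move=> bF; rewrite /sw comulM /tens_mul {2}/tens_lift linear_sum.
apply: eq_bigr => i _; rewrite linear_sum; apply: eq_bigr => j _.
by rewrite linearZ /= tens_lift_comp.
Qed.

Lemma sw1 W (F : H -> H -> W) : is_bil F -> sw F 1 = F 1 1.
Proof. by case=> Fl Fr; rewrite /sw comul1 tens_liftE. Qed.

End Sweedler.

(* Multilinearity side conditions: F must be an explicit abstraction, whose body
   is traversed down to linear hypotheses and structures. *)
Ltac lin :=
  lazymatch goal with
  | |- forall _, _ => let x := fresh "x" in intro x; cbv beta; lin
  | |- is_bil _ => split; lin
  | |- is_lin (fun x => x) => apply: lin_id
  | |- @is_lin ?K ?V ?W (fun x => (@?f x) *: (@?g x)) =>
      lazymatch f with
      | fun _ => ?a => apply: (@lin_scaler K V W a g); lin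
      | _ => apply: (@lin_scalel K V W f); lin
      end
  | |- is_lin (fun x => (@?f x) + (@?g x)) => apply: (@lin_add _ _ _ f g); lin
  | |- is_lin (fun x => (@?f x) * (@?g x)) =>
      lazymatch f with
      | fun _ => ?a => apply: (@lin_mulr _ _ _ g a); lin
      | _ => apply: (@lin_mull _ _ _ f); lin
      end
  | |- is_lin (fun x => @sw _ _ ?A _ (@?F x) (@?h x)) =>
      lazymatch h with
      | fun _ => ?a => apply: (@lin_sw_fun _ _ A _ _ F); lin
      | _ => lazymatch F with
             fun _ => ?G => apply: (@lin_comp _ _ _ _ _ h (@sw_lin _ _ A _ G)); lin
             end
      end
  | |- is_lin (fun x => \sum_(i <- _ | _) (@?F i x)) =>
      apply: (@lin_sum _ _ _ _ _ _ F); lin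
  | |- is_lin (fun x => ?f (@?g x)) => first
      [ lin_head
      | lazymatch g with
        | fun x => x => lazymatch goal with
          |- @is_lin ?K ?V ?W _ => change (@is_lin K V W f); lin_head end
        | _ => apply: (@lin_comp _ _ _ _ f g); [lin_head | lin]
        end
      | lazymatch goal with |- is_lin (fun x => ?f (@?g x) ?b) =>
          apply: (@lin_comp _ _ _ _ (fun y => f y b) g); [lin_head | lin]
        end
      | lazymatch goal with |- is_lin (fun x => ?f (@?g x) ?b ?c) =>
          apply: (@lin_comp _ _ _ _ (fun y => f y b c) g); [lin_head | lin]
        end ]
  | |- is_lin _ => lin_head
  end
with lin_head := first [assumption | exact: lin_struct | solve [auto 3]
  | match goal with h : is_bil _ |- _ =>
      solve [apply: (proj1 h) | apply: (proj2 h)]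
    end ].

(** * The antipode reverses products and coproducts; convolution products *)

Section Antipode.
Variables (K : fieldType) (H : falgType K) (A : hopf_algebra H).
Implicit Types (W : vectType K) (h k a b c : H).
Local Notation ε := (counit A).
Local Notation S := (antipode A).
Local Notation "'\sw_' ( a , b <- h ) E" := (sw A (fun a b => E) h).

Lemma antipode1 : S 1 = 1.
Proof.
have := antipodel A 1; rewrite -/(sw A _ 1) sw1; last by lin.
by rewrite mulr1 counit1 scale1r.
Qed.

Lemma counit_antipode h : ε (S h) = ε h.
Proof.
have E : \sw_(a, b <- h) (ε (S a) *: (ε b : K^o)) = ε h.
  rewrite -[RHS]mulr1 -(counit1 A) -[RHS]/(ε h *: (ε 1 : K^o)).
  rewrite -(@sw_antipodel _ _ A K^o (fun x => ε x)); last by lin.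
  by apply: eq_sw => a b; rewrite counitM.
rewrite -E; under eq_sw => a b do rewrite [_ *: _]mulrC.
by rewrite -[LHS](@sw_counitr _ _ A K^o (fun x => ε (S x))) //; lin.
Qed.

(* Both sides arise from S(a_1 b_1) a_2 b_2 S(b_3) S(a_3). *)
Lemma antipodeM a b : S (a * b) = S b * S a.
Proof.
transitivity (\sw_(a1, a2 <- a) \sw_(b1, b2 <- b) \sw_(c, d <- a2)
   \sw_(e, f <- b2) (S (a1 * b1) * (c * (e * S f) * S d))).
  transitivity (\sw_(a1, a2 <- a) (ε a2 *: S (a1 * b))).
    by rewrite (@sw_counitr _ _ A H (fun a1 => S (a1 * b))) //; lin.
  apply: eq_sw => a1 a2.
  transitivity (\sw_(b1, b2 <- b) (ε b2 *: (ε a2 *: S (a1 * b1)))).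
    by rewrite (@sw_counitr _ _ A H (fun b1 => ε a2 *: S (a1 * b1))) //; lin.
  apply: eq_sw => b1 b2; apply/esym.
  under eq_sw => c d do
    [rewrite (@sw_antipoder _ _ A H (fun y => S (a1 * b1) * (c * y * S d)));
    last by lin].
  rewrite -(@sw_map _ _ A H H ( *:%R (ε b2))); last by lin.
  under eq_sw => c d do rewrite mulr1.
  rewrite (@sw_antipoder _ _ A H (fun y => S (a1 * b1) * y)); last by lin.
  by rewrite mulr1.
transitivity (\sw_(x, d <- a) \sw_(y, f <- b) (ε x *: (ε y *: (S f * S d)))).
  under eq_sw => a1 a2 do rewrite sw_swap.
  rewrite -(@sw_assoc _ _ A H (fun a1 c d => \sw_(b1, b2 <- b)
     \sw_(e, f <- b2) (S (a1 * b1) * (c * (e * S f) * S d)))); try lin.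
  apply: eq_sw => x d.
  under eq_sw => a1 c do
    [rewrite -(@sw_assoc _ _ A H (fun b1 e f =>
       S (a1 * b1) * (c * (e * S f) * S d))); try lin].
  rewrite sw_swap; apply: eq_sw => y f.
  under eq_sw => a1 c do under eq_sw => b1 e do
    [rewrite (_ : _ * _ = S (a1 * b1) * (c * e) * (S f * S d));
     last by rewrite !mulrA].
  rewrite -(@swM _ _ A H (fun p q => S p * q * (S f * S d))); last by lin.
  rewrite (@sw_antipodel _ _ A H (fun y => y * (S f * S d))); last by lin.
  by rewrite mul1r counitM scalerA.
under eq_sw => x d do
  [rewrite -(@sw_map _ _ A H H ( *:%R (ε x))) ?sw_counitl; try lin].
by rewrite (@sw_counitl _ _ A H (fun d => S b * S d)) //; lin.
Qed.
(* Both sides arise from F (S(h_1)_1 h_2 S(h_5)) (S(h_1)_2 h_3 S(h_4)). *)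
Lemma sw_antipode W (F : H -> H -> W) h : is_bil F ->
  \sw_(a, b <- S h) F a b = \sw_(a, b <- h) F (S b) (S a).
Proof.
move=> bF; pose G u p q := \sw_(x, y <- u) F (x * p) (y * q).
have lG1 p q : is_lin (fun u => G u p q) by rewrite /G; lin.
have lG2 u q : is_lin (fun p => G u p q) by rewrite /G; lin.
have lG3 u p : is_lin (fun q => G u p q) by rewrite /G; lin.
have GM u v p q : G (u * v) p q = \sw_(x, y <- v) G u (x * p) (y * q).
  rewrite /G swM; last by lin.
  by rewrite sw_swap; do 2!(apply: eq_sw => ? ?); rewrite !mulrA.
(* The expression c_1 S(c_4) ⊗ c_2 S(c_3) collapses from the inside: first c_2 S(c_3), then the
   outer pair. *)
have contr u c : \sw_(p, q <- c) \sw_(p1, p2 <- p) \sw_(q1, q2 <- q)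
    G u (p1 * S q2) (p2 * S q1) = ε c *: G u 1 1.
  rewrite (@sw_assoc _ _ A W (fun p1 p2 q => \sw_(q1, q2 <- q)
    G u (p1 * S q2) (p2 * S q1))); try lin.
  rewrite -(@sw_antipoder _ _ A W (fun p => G u p 1)); last by lin.
  apply: eq_sw => p1 r.
  rewrite -(@sw_assoc _ _ A W (fun p2 q1 q2 =>
    G u (p1 * S q2) (p2 * S q1))); try lin.
  rewrite -[RHS](@sw_counitl _ _ A W (fun r => G u (p1 * S r) 1)); last by lin.
  apply: eq_sw => t q2.
  by rewrite (@sw_antipoder _ _ A W (fun y => G u (p1 * S q2) y)); last by lin.
transitivity (G (S h) 1 1).
  by apply: eq_sw => x y; rewrite !mulr1.
rewrite -[LHS](@sw_counitr _ _ A W (fun c1 => G (S c1) 1 1)); last by lin.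
under eq_sw => c1 w do rewrite -contr.
rewrite -(@sw_assoc _ _ A W (fun c1 p q => \sw_(p1, p2 <- p) \sw_(q1, q2 <- q)
  G (S c1) (p1 * S q2) (p2 * S q1))); try lin.
rewrite -[RHS](@sw_counitl _ _ A W (fun r => \sw_(a, b <- r) F (S b) (S a)));
  last by lin.
apply: eq_sw => c r.
under eq_sw => c1 c2 do rewrite sw_swap.
rewrite sw_swap (@sw_map _ _ A W W ( *:%R (ε c))); last by lin.
apply: eq_sw => a b.
under eq_sw => c1 c2 do rewrite -GM.
rewrite (@sw_antipodel _ _ A W (fun u => G u (S b) (S a))); last by lin.
by rewrite /G sw1 ?mul1r //; lin.
Qed.

Lemma antipode2M a b : S (S (a * b)) = S (S a) * S (S b).
Proof. by rewrite !antipodeM. Qed.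

Lemma sw_antipode2 W (F : H -> H -> W) h : is_bil F ->
  \sw_(a, b <- S (S h)) F a b = \sw_(a, b <- h) F (S (S a)) (S (S b)).
Proof.
move=> bF; rewrite sw_antipode // sw_antipode //; lin.
Qed.

(** The product of a list in the convolution algebra Hom(H, B). Taking B to be H, [K^o] or a matrix
    algebra covers Sweedler powers, functionals and actions on tensor powers alike. *)
Fixpoint conv_seq (B : falgType K) (fs : seq (H -> B)) h : B :=
  if fs is f :: fs' then \sw_(a, b <- h) (f a * conv_seq fs' b) else ε h *: 1.

Lemma lin_conv_seq (B : falgType K) (fs : seq (H -> B)) :
  is_lin (conv_seq fs).
Proof. by case: fs => [|f fs] /=; lin. Qed.

Lemma conv_seq_cat (B : falgType K) (fs gs : seq (H -> B)) h :
  (forall i, is_lin (nth (fun _ => 0) fs i)) ->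
  conv_seq (fs ++ gs) h = \sw_(a, b <- h) (conv_seq fs a * conv_seq gs b).
Proof.
have lc := @lin_conv_seq B.
elim: fs h => [|f fs IH] h lfs /=.
  under eq_sw => a b do rewrite -scalerAl mul1r.
  by rewrite (@sw_counitl _ _ A B (conv_seq gs)).
have lf : is_lin f := lfs 0.
have {}IH := IH ^~ (fun i => lfs i.+1).
under eq_sw => a b do rewrite IH.
under [in RHS]eq_sw => a b do
  [rewrite (@sw_map _ _ A B B (fun x => x * conv_seq gs b)); last by lin].
rewrite (@sw_assoc _ _ A B
  (fun a b c => f a * conv_seq fs b * conv_seq gs c)); try lin.
apply: eq_sw => a y; rewrite (@sw_map _ _ A B B (fun x => f a * x)); last by lin.
by apply: eq_sw => b c; rewrite mulrA.
Qed.

End Antipode.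

(** * Sweedler powers as convolution powers of the identity *)

Section Powers.
Variables (K : fieldType) (H : falgType K) (A : hopf_algebra H).
Implicit Types (W : vectType K) (h k a b c : H).
Local Notation ε := (counit A).
Local Notation S := (antipode A).
Local Notation "'\sw_' ( a , b <- h ) E" := (sw A (fun a b => E) h).

Definition conv_pow (f : H -> H) n h : H := conv_seq A (nseq n f) h.

Lemma lin_conv_pow f n : is_lin (conv_pow f n).
Proof. exact: lin_conv_seq. Qed.

Lemma lin_nseq (B : falgType K) (f : H -> B) n : is_lin f ->
  forall i, is_lin (nth (fun _ => 0) (nseq n f) i).
Proof.
move=> lf i; rewrite nth_nseq; case: ifP => // _ a x y.
by rewrite addr0 scaler0.
Qed.

Lemma conv_pow_add f m n h : is_lin f ->
  conv_pow f (m + n) h = \sw_(a, b <- h) (conv_pow f m a * conv_pow f n b).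
Proof.
by move=> lf; rewrite /conv_pow nseqD conv_seq_cat //; apply: lin_nseq.
Qed.

Lemma conv_pow1 f h : is_lin f -> conv_pow f 1 h = f h.
Proof.
move=> lf; rewrite /conv_pow /=; under eq_sw => a b do rewrite -scalerAr mulr1.
exact: sw_counitr.
Qed.

Lemma sweedler_powE n h : sweedler_pow A n h = conv_pow id n h.
Proof.
have lid : is_lin (id : H -> H) by [].
case: n => // n /=; elim: n h => [|n IH] h; first by rewrite conv_pow1.
(* [iter_comul] splits off the last tensor factor, [conv_seq] the first one. *)
rewrite -(addn1 n.+1) conv_pow_add //= /tens_map.
have litm : is_bil (fun (x : tens_pow H n) (a : H) => iter_mul x * a).
  split=> [y a u v|x a u v]; last by rewrite mulrDr scalerAr.
  rewrite scalerAl -mulrDl; congr (_ * _).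
  by case: (n) u v => // n' u v /=; rewrite linearP.
rewrite [LHS]tens_lift_comp //; apply: (@eq_sw _ _ A H) => a b.
by rewrite IH conv_pow1.
Qed.

(** The innermost pair h_(n) S(h_(n+1)) cancels, and induction does the rest: the n-th convolution
    power of S is a right inverse of that of the identity. *)
Lemma conv_pow_antipodeV n h :
  \sw_(a, b <- h) (conv_pow id n a * conv_pow S n b) = ε h *: 1.
Proof.
have lid : is_lin (id : H -> H) by [].
have lS : is_lin S by lin.
have lp f m := @lin_conv_pow f m.
elim: n h => [|n IH] h.
  under eq_sw => a b do rewrite /conv_pow /= -scalerAl mul1r.
  by rewrite (@sw_counitl _ _ A H (fun b => ε b *: 1)) //; lin.
rewrite -IH; transitivity (\sw_(a, b <- h) \sw_(a1, a2 <- a)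
    \sw_(b1, b2 <- b) (conv_pow id n a1 * (a2 * S b1) * conv_pow S n b2)).
  apply: eq_sw => a b; rewrite -addn1 conv_pow_add // addn1.
  rewrite (@sw_map _ _ A H H (fun x => x * conv_pow S n.+1 b)); last by lin.
  apply: eq_sw => a1 a2; rewrite conv_pow1 // {2}/conv_pow /=.
  rewrite (@sw_map _ _ A H H (fun x => conv_pow id n a1 * a2 * x)); last by lin.
  by apply: eq_sw => b1 b2; rewrite !mulrA.
rewrite (@sw_assoc _ _ A H (fun a1 a2 b => \sw_(b1, b2 <- b)
  (conv_pow id n a1 * (a2 * S b1) * conv_pow S n b2))); try lin.
apply: eq_sw => a1 r.
rewrite -(@sw_assoc _ _ A H (fun a2 b1 b2 =>
  (conv_pow id n a1 * (a2 * S b1) * conv_pow S n b2))); try lin.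
under eq_sw => t b2 do [rewrite (@sw_antipoder _ _ A H (fun u =>
  conv_pow id n a1 * u * conv_pow S n b2)); last by lin].
rewrite (@sw_counitl _ _ A H (fun b2 => conv_pow id n a1 * 1 * conv_pow S n b2)).
  by rewrite mulr1.
lin.
Qed.

(** If the e-th power of the identity is the convolution unit, so is its inverse, the e-th power of
    S; exponents of S may thus be reduced modulo e. *)
Lemma conv_pow_antipode_exp e n h : sweedler_trivial A e ->
  conv_pow S (n * e + 1) h = S h.
Proof.
move=> triv; have lS : is_lin S by lin.
have {}triv k : conv_pow S e k = ε k *: 1.
  rewrite -(conv_pow_antipodeV e).
  under eq_sw => a b do rewrite -sweedler_powE triv -scalerAl mul1r.
  by rewrite sw_counitl //; apply: lin_conv_pow.
elim: n h => [|n IH] h; first by rewrite conv_pow1.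
rewrite mulSn -addnA conv_pow_add //.
under eq_sw => a b do rewrite triv IH -scalerAl mul1r.
by rewrite sw_counitl.
Qed.

End Powers.

(** * Traces on H and the integral [lam] of the dual *)

Section Trace.
Variables (K : fieldType) (H : falgType K) (A : hopf_algebra H).
Implicit Types (W : vectType K) (h a b c : H).
Local Notation ε := (counit A).
Local Notation S := (antipode A).
Local Notation "'\sw_' ( a , b <- h ) E" := (sw A (fun a b => E) h).

Local Notation bas i := (vbasis {:H})`_i.

Definition crd i : H -> K^o := coord (vbasis {:H}) i.

Lemma lin_crd i : is_lin (crd i). Proof. exact: linearP. Qed.
Hint Resolve lin_crd : core.

Lemma crd_sum h : h = \sum_(i < \dim {:H}) crd i h *: bas i.
Proof. exact: (coord_vbasis (memvf h)). Qed.

Lemma crd_bas i (j : 'I_(\dim {:H})) : crd i (bas j) = (i == j)%:R.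
Proof.
have fH := basis_free (vbasisP {:H}).
by apply: etrans (coord_free j i fH) _; rewrite eq_sym.
Qed.

Lemma crd_inj h (k : H) : (forall i, crd i h = crd i k) -> h = k.
Proof.
move=> E; rewrite (crd_sum h) (crd_sum k).
by apply: eq_bigr => i _; rewrite E.
Qed.

Lemma crd_lin (W : lmodType K) (M : H -> W) h : is_lin M ->
  \sum_(i < \dim {:H}) crd i h *: M (bas i) = M h.
Proof.
move=> lM; rewrite {2}(crd_sum h) (is_lin_sum lM).
by apply: eq_bigr => i _; rewrite is_linZ.
Qed.

Lemma sw_sum W I r (P : pred I) (F : I -> H -> H -> W) h :
  \sw_(a, b <- h) (\sum_(i <- r | P i) F i a b)
  = \sum_(i <- r | P i) \sw_(a, b <- h) F i a b.
Proof.
rewrite /sw /tens_lift [RHS]exchange_big; apply: eq_bigr => i _.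
rewrite [RHS]exchange_big; apply: eq_bigr => j _; exact: scaler_sumr.
Qed.

Definition trH (F : H -> H) : K^o := \sum_(i < \dim {:H}) crd i (F (bas i)).

Lemma eq_trH F G : F =1 G -> trH F = trH G.
Proof. by move=> FG; apply: eq_bigr => i _; rewrite FG. Qed.

Lemma trHC F G : is_lin F -> is_lin G ->
  trH (fun x => F (G x)) = trH (fun x => G (F x)).
Proof.
move=> lF lG; pose f (i j : 'I_(\dim {:H})) : K^o := crd i (F (bas j)).
pose g (i j : 'I_(\dim {:H})) : K^o := crd i (G (bas j)).
transitivity (\sum_(i < \dim {:H}) \sum_(j < \dim {:H}) g j i *: f i j).
  apply: eq_bigr => i _; rewrite /f.
  by rewrite (@crd_lin K^o (fun x => crd i (F x))) //; lin.
rewrite exchange_big; apply: eq_bigr => j _.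
transitivity (\sum_(i < \dim {:H}) f i j *: g j i).
  by apply: eq_bigr => i _; rewrite /GRing.scale /= mulrC.
by rewrite (@crd_lin K^o (fun x => crd j (G x))) //; lin.
Qed.

(* Cyclicity of the trace for G : H ⊗ H -> H and the coproduct of H. *)
Lemma trH_sw (G : H -> H -> H) : is_bil G ->
  trH (fun x => sw A G x) = \sum_(j < \dim {:H}) \sum_(k < \dim {:H})
    \sw_(a, b <- G (bas j) (bas k))    (crd j a *: crd k b).
Proof.
move=> bG; pose D j k h : K^o := \sw_(a, b <- h) (crd j a *: crd k b).
transitivity (\sum_(i < \dim {:H}) \sum_(j < \dim {:H}) \sum_(k < \dim {:H})
  crd i (G (bas j) (bas k)) *: D j k (bas i)).
  apply: eq_bigr => i _; rewrite /D (@sw_map _ _ A H K^o (crd i)) //.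
  transitivity (\sw_(a, b <- bas i) (\sum_(j < \dim {:H}) \sum_(k < \dim {:H})
      crd i (G (bas j) (bas k)) *: (crd j a *: crd k b))).
    apply: eq_sw => a b.
    rewrite -(@crd_lin K^o (fun x => crd i (G x b))); last by lin.
    apply: eq_bigr => j _.
    rewrite -(@crd_lin K^o (fun x => crd i (G (bas j) x))); last by lin.
    rewrite scaler_sumr; apply: eq_bigr => k _; rewrite scalerA.
    by rewrite /GRing.scale /= mulrC.
  rewrite sw_sum; apply: eq_bigr => j _; rewrite sw_sum; apply: eq_bigr => k _.
  by rewrite -(@sw_map _ _ A K^o K^o ( *:%R (crd i (G (bas j) (bas k))))) //; lin.
rewrite exchange_big; apply: eq_bigr => j _.
rewrite exchange_big; apply: eq_bigr => k _.
by rewrite (@crd_lin K^o (D j k)) // /D; lin.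
Qed.

Definition lam h : K^o := trH (fun x => h * S (S x)).

Lemma lin_lam : is_lin lam.
Proof. rewrite /lam /trH; lin. Qed.
Hint Resolve lin_lam : core.

(** Cyclicity of the trace and multiplicativity of S²: the latter acts as a Nakayama automorphism
    for [lam]. *)
Lemma lamC h (k : H) : lam (h * k) = lam (k * S (S h)).
Proof.
transitivity (trH (fun x => h * (k * S (S x)))).
  by apply: eq_trH => x; rewrite mulrA.
rewrite (@trHC (fun y => h * y) (fun x => k * S (S x))); try lin.
by apply: eq_trH => x; rewrite antipode2M mulrA.
Qed.

(* Since S²(x_2) S(x_1) = ε(x), f(h_1) h_2 S²(x) is G applied to the coproduct
   of x, where G y z = f(k_1 S(y)) k_2 for k = h S²(z); now use [trH_sw]. *)
Lemma lam_int_scalar (f : H -> K^o) h : is_lin f ->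
  \sw_(a, b <- h) (lam b *: f a) = lam h *: f 1.
Proof.
move=> lf.
pose G y z : H := \sw_(k1, k2 <- h * S (S z)) (f (k1 * S y) *: k2).
have bG : is_bil G by rewrite /G; lin.
have key x : \sw_(a, b <- h) (f a *: (b * S (S x))) = sw A G x.
  transitivity (\sw_(y, z <- x) \sw_(h1, h2 <- h) \sw_(z1, z2 <- z)
      (f (h1 * (S (S z1) * S y)) *: (h2 * S (S z2)))); last first.
    apply: eq_sw => y z; rewrite /G swM; last by lin.
    apply: eq_sw => h1 h2; rewrite sw_antipode2; last by lin.
    by apply: eq_sw => z1 z2; rewrite mulrA.
  rewrite sw_swap; apply: eq_sw => h1 h2.
  rewrite -(@sw_assoc _ _ A H (fun y z1 z2 =>
    (f (h1 * (S (S z1) * S y)) *: (h2 * S (S z2))))); try lin.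
  rewrite -(@sw_counitl _ _ A H (fun x => f h1 *: (h2 * S (S x)))); last by lin.
  apply: eq_sw => t z2; under [RHS]eq_sw => y z1 do rewrite -antipodeM.
  rewrite (@sw_antipoder _ _ A H (fun u => f (h1 * S u) *: (h2 * S (S z2)))).
    by rewrite antipode1 mulr1.
  lin.
transitivity (trH (fun x => sw A G x)).
  transitivity (\sum_(i < \dim {:H})
    \sw_(a, b <- h) (f a *: crd i (b * S (S (bas i))))).
    rewrite -sw_sum; apply: eq_sw => a b; rewrite -scaler_sumr.
    by rewrite /GRing.scale /= mulrC.
  apply: eq_bigr => i _; rewrite -key (@sw_map _ _ A H K^o (crd i)) //.
  by apply: eq_sw => a b; rewrite (is_linZ (lin_crd i)).
rewrite trH_sw // exchange_big /lam /trH scaler_suml; apply: eq_bigr => k _.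
transitivity (\sw_(k1, r <- h * S (S (bas k))) \sw_(a, b <- r)
    (f (k1 * S a) *: crd k b)).
  transitivity (\sum_(j < \dim {:H}) \sw_(k1, k2 <- h * S (S (bas k)))
     \sw_(a, b <- k2) (f (k1 * S (bas j)) *: (crd j a *: crd k b))).
    apply: eq_bigr => j _; rewrite /G.
    rewrite (@sw_map _ _ A H K^o (sw A (fun a b => crd j a *: crd k b))).
      apply: eq_sw => k1 k2; rewrite (is_linZ (@sw_lin _ _ A _ _)).
      by rewrite (@sw_map _ _ A K^o K^o ( *:%R (f (k1 * S (bas j))))) //; lin.
    exact: sw_lin.
  rewrite -sw_sum; apply: eq_sw => k1 k2; rewrite -sw_sum.
  apply: eq_sw => a b; rewrite -(@crd_lin K^o (fun a => f (k1 * S a))).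
    rewrite scaler_suml; apply: eq_bigr => j _; rewrite !scalerA.
    by rewrite /GRing.scale /= (mulrC (f _)).
  lin.
rewrite -(@sw_assoc _ _ A K^o (fun k1 a b => (f (k1 * S a) *: crd k b))); try lin.
under eq_sw => t b do [rewrite (@sw_antipoder _ _ A K^o
  (fun u => f u *: crd k b)); last by lin].
rewrite (@sw_counitl _ _ A K^o (fun b => f 1 *: crd k b)); last by lin.
by rewrite /GRing.scale /= mulrC.
Qed.

(** Coordinates separate points, so the scalar case yields lam(h_(2)) h_(1) = lam(h) 1, to which M
    is applied. *)
Lemma lam_int W (M : H -> W) h : is_lin M ->
  \sw_(a, b <- h) (lam b *: M a) = lam h *: M 1.
Proof.
move=> lM; rewrite -(is_linZ lM); transitivity (M (\sw_(a, b <- h) (lam b *: a))).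
  rewrite (@sw_map _ _ A H W M) //.
  by apply: eq_sw => a b; rewrite is_linZ.
congr (M _); apply: crd_inj => i; rewrite (is_linZ (lin_crd i)).
rewrite -lam_int_scalar // (@sw_map _ _ A H K^o (crd i)) //.
by apply: eq_sw => a b; rewrite (is_linZ (lin_crd i)).
Qed.

End Trace.

(** * The integral L of H, the group-like element g and the finite order of S *)

Section Integral.
Variables (K : fieldType) (H : falgType K) (A : hopf_algebra H).
Implicit Types (W : vectType K) (h a b c : H).
Local Notation ε := (counit A).
Local Notation S := (antipode A).
Local Notation "'\sw_' ( a , b <- h ) E" := (sw A (fun a b => E) h).
Local Notation bas i := (vbasis {:H})`_i.
Local Notation lam := (lam A).
Local Notation lin_lam := (@lin_lam K H A).

Lemma mu_int W (M : H -> W) h : is_lin M ->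
  \sw_(a, b <- h) (lam (S a) *: M (S b)) = lam (S h) *: M 1.
Proof.
have := lin_lam => ll lM; rewrite -lam_int // sw_antipode //; lin.
Qed.

(** Cyclicity moves one S around; this expresses lam o S by right multiplications, which are the
    ones acting on tensor powers later. *)
Lemma lam_antipode h : lam (S h) = trH (fun x => S (S (x * h))).
Proof.
rewrite (@trHC _ _ S (fun x => S (x * h))); try lin.
by apply: eq_trH => x; rewrite antipodeM.
Qed.

Definition two_sided_integral (L : H) :=
  (forall h, h * L = ε h *: L) /\ (forall h, L * h = ε h *: L).

Variable L : H.
Hypothesis intL : two_sided_integral L.
Hypothesis epsL : ε L = 1.

(** The operator x |-> L S²(x) = ε(x) L has rank one and trace ε(L). *)
Lemma lamL : lam L = 1.
Proof.
rewrite -epsL -[RHS](@crd_lin _ _ K^o (fun x => ε x)); last by lin.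
apply: eq_bigr => i _; rewrite intL.2 !counit_antipode.
by rewrite (is_linZ (lin_crd i)) /GRing.scale /= mulrC.
Qed.

Lemma lam_antipodeL : lam (S L) = 1.
Proof.
rewrite -epsL -(counit_antipode A L).
rewrite -[RHS](@crd_lin _ _ K^o (fun x => ε x)); last by lin.
apply: eq_bigr => i _; rewrite -antipodeM intL.1 counit_antipode linearZ /=.
by rewrite (is_linZ (lin_crd i)) /GRing.scale /= mulrC.
Qed.

(** Both sides equal S(h_(1)) h_(2) L_(1) ⊗ h_(3) L_(2): cancel the first two factors, or absorb the
    coproduct of h_(2) into L. *)
Lemma integral_left W (F : H -> H -> W) h : is_bil F ->
  \sw_(x, y <- L) F x (h * y) = \sw_(x, y <- L) F (S h * x) y.
Proof.
move=> bF.
transitivity (\sw_(t, c <- h) \sw_(a, b <- t) \sw_(x, y <- L)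
    (F (S a * b * x) (c * y))).
  transitivity (\sw_(t, c <- h) (ε t *: \sw_(x, y <- L) F x (c * y))).
    by rewrite (@sw_counitl _ _ A W (fun c => \sw_(x, y <- L) F x (c * y))) //; lin.
  apply: eq_sw => t c.
  rewrite (@sw_antipodel _ _ A W
    (fun u => \sw_(x, y <- L) F (u * x) (c * y))); last by lin.
  by congr (_ *: _); apply: eq_sw => x y; rewrite mul1r.
rewrite (@sw_assoc _ _ A W (fun a b c => \sw_(x, y <- L)
    (F (S a * b * x) (c * y)))); try lin.
rewrite -(@sw_counitr _ _ A W (fun a => \sw_(x, y <- L) F (S a * x) y));
  last by lin.
apply: eq_sw => a r; rewrite -(is_linZ (@sw_lin _ _ A _ _)) -intL.1 swM;
  last by lin.
by do 2!(apply: eq_sw => ? ?); rewrite mulrA.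
Qed.

(** Mirror image of [integral_left], with L_(1) h_(1) ⊗ L_(2) h_(2) S(h_(3)) as the common value. *)
Lemma integral_right W (F : H -> H -> W) h : is_bil F ->
  \sw_(x, y <- L) F (x * h) y = \sw_(x, y <- L) F x (y * S h).
Proof.
move=> bF.
transitivity (\sw_(a, r <- h) \sw_(b, c <- r) \sw_(x, y <- L)
    (F (x * a) (y * (b * S c)))).
  transitivity (\sw_(a, r <- h) (ε r *: \sw_(x, y <- L) F (x * a) y)).
    by rewrite (@sw_counitr _ _ A W (fun a => \sw_(x, y <- L) F (x * a) y)) //; lin.
  apply: eq_sw => a r.
  rewrite (@sw_antipoder _ _ A W
    (fun u => \sw_(x, y <- L) F (x * a) (y * u))); last by lin.
  by congr (_ *: _); apply: eq_sw => x y; rewrite mulr1.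
rewrite -(@sw_assoc _ _ A W (fun a b c => \sw_(x, y <- L)
    (F (x * a) (y * (b * S c))))); try lin.
rewrite -(@sw_counitl _ _ A W (fun c => \sw_(x, y <- L) F x (y * S c)));
  last by lin.
apply: eq_sw => a r; rewrite -(is_linZ (@sw_lin _ _ A _ _)) -intL.2 swM;
  last by lin.
rewrite sw_swap; do 2!(apply: eq_sw => ? ?); by rewrite mulrA.
Qed.

(** The distinguished group-like element: by [lam_modular] it measures the failure of [lam] to be an
    integral on the other side. *)
Definition modular : H := \sw_(x, y <- L) (lam x *: y).
Local Notation g := modular.

(** A case of Radford's S^4 formula: h g = lam(S(h) L_(1)) L_(2) = lam(L_(1) S³(h)) L_(2) = g
    S^4(h). *)
Lemma modular_comm h : h * g = g * S (S (S (S h))).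
Proof.
have ll := lin_lam.
rewrite /g (@sw_map _ _ A H H (fun y => h * y)); last by lin.
transitivity (\sw_(x, y <- L) (lam (S h * x) *: y)).
  rewrite -(@integral_left H (fun x y => lam x *: y)); last by lin.
  by apply: eq_sw => x y; rewrite scalerAr.
under eq_sw => x y do rewrite lamC.
rewrite (@integral_right H (fun x y => lam x *: y)); last by lin.
rewrite (@sw_map _ _ A H H (fun y => y * S (S (S (S h))))); last by lin.
by apply: eq_sw => x y; rewrite scalerAl.
Qed.

(* L_1 lam(L_2 S(h)) = h shows that f |-> L_1 f(L_2) is onto, hence bijective. *)
Lemma integral_nondeg (f : H -> K^o) : is_lin f ->
  \sw_(x, y <- L) (f y *: x) = 0 -> forall h, f h = 0.
Proof.
have ll := lin_lam => lf f0.
(* Tensors are coordinate matrices, so D is Δ(L) itself; the columns of D X are the coordinates of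
   L_(1) lam(L_(2) S(b)) = b for basis vectors b. *)
pose D : 'M[K]_(\dim {:H}) := comul A L.
pose X : 'M[K]_(\dim {:H}) := \matrix_(j, i) lam (bas j * S (bas i)).
have DX : D *m X = 1%:M.
  apply/matrixP => k i; rewrite !mxE.
  have E : \sw_(x, y <- L) (lam (y * S (bas i)) *: x) = bas i.
    rewrite -(@integral_right H (fun x y => lam y *: x)); last by lin.
    rewrite (@lam_int _ _ A H (fun x => x * bas i)); last by lin.
    by rewrite lamL scale1r mul1r.
  rewrite -(crd_bas k i) -E (@sw_map _ _ A H K^o (@crd K H k)); last exact: lin_crd.
  rewrite /sw /tens_lift [RHS](bigD1 k) //= [X in _ = _ + X]big1 ?addr0 => [|l lk].
    apply: eq_bigr => j _; rewrite mxE (is_linZ (lin_crd k)) crd_bas eqxx.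
    by rewrite /GRing.scale /= mulr1.
  apply: big1 => j _; rewrite (is_linZ (lin_crd k)) crd_bas eq_sym (negPf lk).
  by rewrite !scaler0.
(* Finite dimension enters here: a one-sided inverse of a square matrix is two-sided. *)
have XD : X *m D = 1%:M by apply: mulmx1C.
pose u : 'cV[K]_(\dim {:H}) := \col_j f (bas j).
have Du : D *m u = 0.
  apply/matrixP => k i; rewrite !mxE.
  have : crd k (\sw_(x, y <- L) (f y *: x)) = 0.
    by rewrite f0 (is_lin0 (lin_crd k)).
  rewrite (@sw_map _ _ A H K^o (@crd K H k)); last exact: lin_crd.
  rewrite /sw /tens_lift (bigD1 k) //= [X in _ + X]big1 ?addr0 => [E|l lk].
    apply: etrans E; apply: eq_bigr => j _.
    rewrite mxE (is_linZ (lin_crd k)) crd_bas eqxx.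
    by rewrite /GRing.scale /= mulr1.
  apply: big1 => j _; rewrite (is_linZ (lin_crd k)) crd_bas eq_sym (negPf lk).
  by rewrite !scaler0.
have u0 : u = 0 by rewrite -[u]mul1mx -XD -mulmxA Du mulmx0.
move=> h; rewrite -(crd_lin h lf) big1 // => j _.
by have /matrixP/(_ j 0) := u0; rewrite !mxE => ->; rewrite scaler0.
Qed.

(* lam convolved with any functional is again an integral of the dual, so it is
   determined by its value at L. *)
Lemma lam_modular W (M : H -> W) h : is_lin M ->
  \sw_(a, b <- h) (lam a *: M b) = lam h *: M g.
Proof.
have ll := lin_lam => lM.
suff E : \sw_(a, b <- h) (lam a *: b) = lam h *: g.
  rewrite -(is_linZ lM) -E (@sw_map _ _ A H W M) //.
  by apply: eq_sw => a b; rewrite is_linZ.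
apply: crd_inj => i; have lc := @lin_crd K H.
pose f1 h : K^o := crd i (\sw_(a, b <- h) (lam a *: b)).
pose f h : K^o := f1 h + (- crd i g) *: lam h.
have lf : is_lin f by rewrite /f /f1; lin.
suff : f h = 0.
  move/eqP; rewrite /f scaleNr subr_eq0 => /eqP; rewrite /f1 => ->.
  by rewrite (is_linZ (lc i)) /GRing.scale /= mulrC.
(* Both terms of f contribute the same: L_(1) lam(L_(2)) crd_i(L_(3)) = crd_i(g) 1 by
   coassociativity, and crd_i(g) L_(1) lam(L_(2)) = crd_i(g) 1. *)
apply: (integral_nondeg lf).
transitivity (\sw_(x, y <- L) (f1 y *: x)
  - \sw_(x, y <- L) (lam y *: (crd i g *: x))).
  rewrite /sw /tens_lift -sumrB; apply: eq_bigr => k _; rewrite -sumrB.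
  apply: eq_bigr => l _; rewrite -scalerBr; congr (_ *: _).
  by rewrite /f scalerDl !scaleNr scalerA (mulrC (lam _)).
rewrite (@lam_int _ _ A H (fun x => crd i g *: x)); last by lin.
rewrite lamL scale1r; apply/eqP; rewrite subr_eq0; apply/eqP.
transitivity (\sw_(x, y <- L) \sw_(a, b <- y) (lam a *: (crd i b *: x))).
  apply: eq_sw => x y; rewrite /f1 (@sw_map _ _ A H K^o (@crd K H i)) //.
  rewrite (@sw_map _ _ A K^o H (fun u => u *: x)); last by lin.
  apply: eq_sw => a b; rewrite (is_linZ (lc i)).
  by rewrite scalerA.
rewrite -(@sw_assoc _ _ A H (fun x a b => (lam a *: (crd i b *: x)))); try lin.
transitivity (\sw_(t, b <- L) (lam t *: (crd i b *: (1 : H)))).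
  apply: eq_sw => t b.
  by rewrite (@lam_int _ _ A H (fun x => crd i b *: x)) //; lin.
rewrite /g (@sw_map _ _ A H K^o (@crd K H i)) //.
rewrite (@sw_map _ _ A K^o H (fun u => u *: (1 : H))).
  apply: eq_sw => t b; rewrite (is_linZ (lc i)).
  by rewrite scalerA.
lin.
Qed.

(** Two uses of [lam_modular]: Δ(g) = lam(L_(1)) L_(2) ⊗ L_(3) = lam(L_(1)) g ⊗ L_(2) = lam(L) g ⊗
    g. *)
Lemma sw_modular W (F : H -> H -> W) : is_bil F -> sw A F g = F g g.
Proof.
have ll := lin_lam => bF.
rewrite {1}/g (@sw_map _ _ A H W (sw A F)); last exact: sw_lin.
transitivity (\sw_(x, y <- L) \sw_(a, b <- y) (lam x *: F a b)).
  apply: eq_sw => x y; rewrite (is_linZ (@sw_lin _ _ A _ _)).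
  by rewrite (@sw_map _ _ A W W ( *:%R (lam x))) //; lin.
rewrite -(@sw_assoc _ _ A W (fun x a b => lam x *: F a b)); try lin.
transitivity (\sw_(t, b <- L) (lam t *: F g b)).
  by apply: eq_sw => t b; rewrite (@lam_modular W (fun a => F a b)) //; lin.
by rewrite (@lam_modular W (F g)) ?lamL ?scale1r //; lin.
Qed.

Lemma counit_modular : ε g = 1.
Proof.
have ll := lin_lam.
rewrite -lamL -(@sw_counitr _ _ A K^o lam L) // /g.
rewrite (@sw_map _ _ A H K^o (counit A)); last by lin.
by apply: eq_sw => x y; rewrite linearZ /= /GRing.scale /= mulrC.
Qed.

(** For a group-like element with counit 1, Sweedler powers are ordinary powers. *)
Lemma modular_exp e : sweedler_trivial A e -> g ^+ e = 1.
Proof.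
have lid : is_lin (id : H -> H) by [].
move=> /(_ g); rewrite counit_modular scale1r => <-; rewrite sweedler_powE.
elim: e => [|e IH]; first by rewrite /conv_pow /= counit_modular scale1r.
rewrite exprS IH /conv_pow /= sw_modular //.
split=> [y|x]; first by lin.
by apply: (lin_comp (@lin_mulr _ _ _ id x lid)); apply: lin_conv_seq.
Qed.

(** Iterating [modular_comm] gives h g^n = g^n S^(4n)(h); take n = e. *)
Lemma antipode_order e h : sweedler_trivial A e -> iter (4 * e) S h = h.
Proof.
move=> triv; have E n : h * g ^+ n = g ^+ n * iter (4 * n) S h.
  elim: n => [|n IH]; first by rewrite mulr1 mul1r.
  rewrite exprSr mulrA IH -mulrA modular_comm mulrA.
  by rewrite mulnS iterD.
by have := E e; rewrite modular_exp // mulr1 mul1r.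
Qed.

End Integral.

(** * Semisimplicity provides a normalized two-sided integral *)

Section SemisimpleIntegral.
Variables (K : fieldType) (H : falgType K) (A : hopf_algebra H).
Local Notation ε := (counit A).

(** The components e_i of 1 in the minimal left ideals are orthogonal idempotents, and ε is 1 on
    exactly one of them; that one is L. *)
Lemma semisimple_integral : semisimple_algebra H ->
  exists L : H, two_sided_integral A L /\ ε L = 1.
Proof.
case=> n [I [minI dxI sumI]].
have idlI i : left_ideal (I i) by case: (minI i).
have : 1 \in (\sum_i I i)%VS by rewrite sumI memvf.
case/memv_sumP => e eI def1; have {}eI i : e i \in I i := eI i isT.
(* Compare x = \sum_k x e_k, where x e_k lies in I_k, with the decomposition having x as its only
   component. *)
have xe i x k : x \in I i -> x * e k = if k == i then x else 0.
  move=> xI; have uV k' : true -> x * e k' \in I k' by move=> _; apply: idlI.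
  have vV k' : true -> (if k' == i then x else 0) \in I k'.
    by move=> _; case: eqP => [->|_] //; apply: mem0v.
  have /directv_sum_unique/(_ _ _ uV vV) := dxI.
  rewrite -mulr_sumr -def1 mulr1 -big_mkcond big_pred1_eq eqxx.
  by move/esym/forall_inP/(_ k isT)/eqP.
have [i0 ei0] : exists i, ε (e i) != 0.
  apply/existsP; apply: contraT; rewrite negb_exists => /forallP e0.
  have := counit1 A; rewrite def1 linear_sum big1 => [/eqP|i _].
    by rewrite eq_sym oner_eq0.
  by have := e0 i; rewrite negbK => /eqP.
have ei01 : ε (e i0) = 1.
  by apply: (mulIf ei0); rewrite -counitM (xe i0) // eqxx mul1r.
have ej0 j : j != i0 -> ε (e j) = 0.
  move=> ji; rewrite -[LHS]mulr1 -ei01 -counitM (xe j) // eq_sym (negPf ji).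
  by rewrite linear0.
pose L := e i0.
have Ll h : h * L = ε h *: L.
  (* J omits L, so minimality forces J = 0; and J contains h L - ε(h) L. *)
  pose J := (I i0 :&: lker ε)%VS.
  have [_ _ /(_ J)] := minI i0; case.
  - move=> a x; rewrite !memv_cap !memv_ker => /andP[xI /eqP x0].
    by rewrite idlI // counitM x0 mulr0 eqxx.
  - exact: capvSl.
  - move=> J0; apply/eqP; rewrite -subr_eq0 -memv0 -J0 memv_cap memv_ker.
    rewrite rpredB ?idlI ?rpredZ ?eI //= linearB linearZ /= counitM ei01.
    by rewrite /GRing.scale /= subrr.
  - move=> JI; have : L \in J by rewrite JI; exact: eI.
    by rewrite memv_cap memv_ker ei01 oner_eq0 andbF.
exists L; split=> //; split=> // h.
have w0 j : j != i0 -> L * h * e j = 0.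
  (* If w were nonzero, its line would be a left ideal, hence all of I_j, with H acting through ε.
     Then e_j = e_j e_j = ε(e_j) e_j = 0 and w = w e_j = 0. *)
  move=> ji; set w := L * h * e j; apply/eqP; apply: contraT => wn0.
  have wI : w \in I j by apply/idlI/eI.
  have kw k : k * w = ε k *: w by rewrite /w !mulrA Ll -!scalerAl.
  have [_ _ /(_ <[w]>%VS)] := minI j; case.
  - by move=> a x /vlineP[c ->]; rewrite -scalerAr kw rpredZ // rpredZ // memv_line.
  - by rewrite -memvE.
  - by move/eqP; rewrite -subv0 -memvE memv0 (negPf wn0).
  - move=> wE; have /vlineP[c ec] : e j \in <[w]>%VS by rewrite wE.
    have ej : e j = 0.
      have E : e j * e j = e j by rewrite (xe j) // eqxx.
      by rewrite -[LHS]E {2}ec -scalerAr kw ej0 // scale0r scaler0.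
    by have := xe j w j wI; rewrite eqxx ej mulr0 => w0; rewrite -w0 eqxx in wn0.
rewrite -[LHS]mulr1 {1}def1 mulr_sumr (bigD1 i0) //= big1 ?addr0 => [|j /w0 //].
by rewrite -mulrA Ll -scalerAr Ll ei01 scale1r.
Qed.

End SemisimpleIntegral.

(** * The regular character of the dual, as an element of H *)

Section RegularCharacter.
Variables (K : fieldType) (H : falgType K) (A : hopf_algebra H).
Implicit Types (W : vectType K) (h a b c : H).
Local Notation ε := (counit A).
Local Notation S := (antipode A).
Local Notation "'\sw_' ( a , b <- h ) E" := (sw A (fun a b => E) h).
Local Notation bas i := (vbasis {:H})`_i.
Local Notation lam := (lam A).

(* As a functional on the dual of H, the character of its regular
   representation. *)
Definition dual_reg : H :=
  \sum_(i < \dim {:H}) \sw_(a, b <- bas i) (crd i a *: b).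
Local Notation xr := dual_reg.

(** The transpose of right multiplication by f in the dual algebra; its trace is the regular
    character at f. *)
Definition shift (f : H -> K^o) h : H := \sw_(a, b <- h) (f b *: a).

Lemma lin_shift (f : H -> K^o) : is_lin (shift f).
Proof. by rewrite /shift; lin. Qed.

Lemma dual_regE (f : H -> K^o) : is_lin f -> f xr = trH (shift f).
Proof.
move=> lf; have lc := @lin_crd K H; rewrite /xr (is_lin_sum lf).
apply: eq_bigr => i _; rewrite (@sw_map _ _ A H K^o f) //.
rewrite /shift (@sw_map _ _ A H K^o (@crd K H i)) //.
apply: eq_sw => a b; rewrite (is_linZ lf) (is_linZ (lc i)).
by rewrite /GRing.scale /= mulrC.
Qed.

Lemma trH_sum_sw (G : H -> H -> H -> H) a :
  trH (fun c => \sw_(a1, a2 <- a) G a1 a2 c) = \sw_(a1, a2 <- a) trH (G a1 a2).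
Proof.
rewrite /trH sw_sum; apply: eq_bigr => i _.
by rewrite (@sw_map _ _ A H K^o (@crd K H i)) //; exact: lin_crd.
Qed.

(** Inserting S(a_(1)) a_(2) gives h_(1) f(a h_(2)) = S(a_(1)) shift f (a_(2) h); cyclicity then
    moves S(a_(1)) to the other side. *)
Lemma dual_reg_mul (f : H -> K^o) a : is_lin f ->
  f (a * xr) = \sw_(a1, a2 <- a) trH (fun c => shift f (a2 * S a1 * c)).
Proof.
move=> lf; rewrite (@dual_regE (fun x => f (a * x))); last by lin.
have ls := lin_shift f.
transitivity (\sw_(a1, a2 <- a) trH (fun c => S a1 * shift f (a2 * c))).
  rewrite -trH_sum_sw; apply: eq_trH => h.
  transitivity (\sw_(a1, a2 <- a) \sw_(u, v <- a2) \sw_(c1, c2 <- h)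
     (f (v * c2) *: (S a1 * u * c1))); last first.
    apply: eq_sw => a1 a2; rewrite /shift swM; last by lin.
    rewrite (@sw_map _ _ A H H (fun x => S a1 * x)); last by lin.
    apply: eq_sw => u v.
    rewrite (@sw_map _ _ A H H (fun x => S a1 * x)); last by lin.
    by apply: eq_sw => c1 c2; rewrite -scalerAr mulrA.
  rewrite -(@sw_assoc _ _ A H (fun a1 u v => \sw_(c1, c2 <- h)
     (f (v * c2) *: (S a1 * u * c1)))); try lin.
  transitivity (\sw_(t, v <- a) (ε t *: \sw_(c1, c2 <- h) (f (v * c2) *: c1))).
    rewrite (@sw_counitl _ _ A H (fun v =>
      \sw_(c1, c2 <- h) (f (v * c2) *: c1))) //; lin.
  apply: eq_sw => t v; rewrite (@sw_antipodel _ _ A H (fun z =>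
    \sw_(c1, c2 <- h) (f (v * c2) *: (z * c1)))); last by lin.
  by congr (_ *: _); apply: eq_sw => c1 c2; rewrite mul1r.
apply: eq_sw => a1 a2.
rewrite (@trHC _ _ (fun x => S a1 * x) (fun c => shift f (a2 * c))); try lin.
by apply: eq_trH => c; rewrite mulrA.
Qed.

(** For F = f ⊗ g the sum is the trace of shift f o shift g, which is symmetric; a general F is
    expanded in products of coordinates. *)
Lemma trace_sw_sym (F : H -> H -> K^o) : is_bil F ->
  \sum_(i < \dim {:H}) \sw_(a, r <- bas i) \sw_(u, v <- r) (crd i a *: F u v)
  = \sum_(i < \dim {:H}) \sw_(a, r <- bas i) \sw_(u, v <- r) (crd i a *: F v u).
Proof.
have lc := @lin_crd K H.
have key (f g : H -> K^o) : is_lin f -> is_lin g ->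
    \sum_(i < \dim {:H}) \sw_(a, r <- bas i) \sw_(u, v <- r)
      (crd i a *: (f u *: g v)) = trH (fun h => shift f (shift g h)).
  move=> lf lg; apply: eq_bigr => i _.
  rewrite -(@sw_assoc _ _ A K^o (fun a u v => crd i a *: (f u *: g v))); try lin.
  rewrite {2}/shift (@sw_map _ _ A H H (shift f)); last exact: lin_shift.
  rewrite (@sw_map _ _ A H K^o (@crd K H i)) //; apply: eq_sw => t v.
  rewrite (is_linZ (@lin_shift f)) (is_linZ (lc i)).
  rewrite (@sw_map _ _ A H K^o (@crd K H i)) //.
  rewrite (@sw_map _ _ A K^o K^o ( *:%R (g v))); last by lin.
  apply: eq_sw => a u; rewrite (is_linZ (lc i)) /GRing.scale /=.
  by rewrite mulrC -mulrA mulrCA.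
move=> bF.
have expand (F' : H -> H -> K^o) : is_bil F' ->
    \sum_(i < \dim {:H}) \sw_(a, r <- bas i) \sw_(u, v <- r) (crd i a *: F' u v)
  = \sum_(j < \dim {:H}) \sum_(k < \dim {:H}) F' (bas j) (bas k) *:
    trH (fun h => shift (@crd K H j) (shift (@crd K H k) h)).
  move=> bF'; transitivity (\sum_(j < \dim {:H}) \sum_(k < \dim {:H})
    F' (bas j) (bas k) *:
    \sum_(i < \dim {:H}) \sw_(a, r <- bas i) \sw_(u, v <- r)
      (crd i a *: (crd j u *: crd k v))); last first.
    by do 2!(apply: eq_bigr => ? _); rewrite key //; apply: lin_crd.
  transitivity (\sum_(i < \dim {:H}) \sum_(j < \dim {:H}) \sum_(k < \dim {:H})
    F' (bas j) (bas k) *: \sw_(a, r <- bas i) \sw_(u, v <- r)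
      (crd i a *: (crd j u *: crd k v))); last first.
    rewrite exchange_big; apply: eq_bigr => j _.
    rewrite exchange_big; apply: eq_bigr => k _.
    by rewrite scaler_sumr.
  apply: eq_bigr => i _.
  transitivity (\sw_(a, r <- bas i) \sw_(u, v <- r) \sum_(j < \dim {:H})
    \sum_(k < \dim {:H}) (F' (bas j) (bas k) *: (crd i a *: (crd j u *: crd k v)))).
    apply: eq_sw => a r; apply: eq_sw => u v.
    rewrite -(@crd_lin _ _ K^o (fun u => F' u v)); last by lin.
    rewrite scaler_sumr; apply: eq_bigr => j _.
    rewrite -(@crd_lin _ _ K^o (fun v => F' (bas j) v)); last by lin.
    rewrite !scaler_sumr; apply: eq_bigr => k _.
    by rewrite /GRing.scale /= !mulrA mulrC !mulrA.
  under eq_sw => a r do [rewrite sw_sum; under eq_bigr => j _ do rewrite sw_sum].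
  rewrite sw_sum; apply: eq_bigr => j _; rewrite sw_sum; apply: eq_bigr => k _.
  rewrite (@sw_map _ _ A K^o K^o ( *:%R (F' (bas j) (bas k)))); last by lin.
  apply: eq_sw => a r.
  by rewrite (@sw_map _ _ A K^o K^o ( *:%R (F' (bas j) (bas k)))) //; lin.
rewrite expand // (expand (fun u v => F v u)); last by lin.
rewrite exchange_big; do 2!(apply: eq_bigr => ? _); congr (_ *: _).
by apply: trHC; apply: lin_shift.
Qed.

(** By [dual_reg_mul], f(x x) involves a factor v S(u). The symmetry [trace_sw_sym] turns it into u
    S(v), which collapses without S² = id. *)
Lemma dual_reg_sqr : xr * xr = (\dim {:H})%:R *: xr.
Proof.
have lc := @lin_crd K H; apply: crd_inj => i; set f := crd i.
have lf : is_lin f := lc i.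
have ls := lin_shift f.
pose phi y := trH (fun c => shift f (y * c)).
have lphi : is_lin phi by rewrite /phi /trH; lin.
rewrite (is_linZ lf) (dual_regE lf).
transitivity (\sum_(i < \dim {:H}) \sw_(a, b <- bas i)
    (crd i a *: f (b * xr))).
  rewrite {1}/xr mulr_suml (is_lin_sum lf); apply: eq_bigr => j _.
  rewrite (@sw_map _ _ A H H (fun y => y * xr)); last by lin.
  rewrite (@sw_map _ _ A H K^o f) //.
  by apply: eq_sw => a b; rewrite -scalerAl (is_linZ lf).
transitivity (\sum_(i < \dim {:H}) \sw_(a, r <- bas i) \sw_(u, v <- r)
    (crd i a *: phi (v * S u))).
  apply: eq_bigr => j _; apply: eq_sw => a b; rewrite dual_reg_mul //.
  by rewrite (@sw_map _ _ A K^o K^o ( *:%R (crd j a))) //; lin.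
rewrite -(@trace_sw_sym (fun u v => phi (u * S v))); last by lin.
transitivity (\sum_(j < \dim {:H}) phi 1).
  apply: eq_bigr => j _.
  transitivity (\sw_(a, r <- bas j) (ε r *: (crd j a *: phi 1))).
    apply: eq_sw => a r.
    rewrite (@sw_antipoder _ _ A K^o (fun y => crd j a *: phi y)) //; lin.
  rewrite (@sw_counitr _ _ A K^o (fun a => crd j a *: phi 1)); last by lin.
  by rewrite crd_bas eqxx scale1r.
rewrite sumr_const card_ord scaler_nat; congr (_ *+ _).
by apply: eq_trH => c; rewrite mul1r.
Qed.

(** As [lam] is an integral, shift lam is the rank-one map h |-> lam(h) 1, of trace lam(1). *)
Lemma lam_dual_reg : lam xr = lam 1.
Proof.
have ll := @lin_lam K H A; rewrite dual_regE //.
rewrite -(crd_lin 1 ll); apply: eq_bigr => i _.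
rewrite /shift (@lam_int _ _ A H id) // (is_linZ (@lin_crd K H i)).
by rewrite /GRing.scale /= mulrC.
Qed.

(** S² is a coalgebra automorphism with inverse T, so it conjugates shift (f o S²) into shift f, and
    traces are invariant under conjugation. *)
Lemma antipode2_dual_reg (T : H -> H) : is_lin T ->
  (forall h, T (S (S h)) = h) -> (forall h, S (S (T h)) = h) ->
  S (S xr) = xr.
Proof.
move=> lT TS ST; apply: crd_inj => i; set f := crd i.
have lf : is_lin f := @lin_crd K H i.
rewrite (dual_regE lf) (@dual_regE (fun x => f (S (S x)))); last by lin.
have ls := lin_shift f.
transitivity (trH (fun h => T (shift f (S (S h))))); last first.
  rewrite (@trHC _ _ T (fun h => shift f (S (S h)))); try lin.
  by apply: eq_trH => h; rewrite ST.
apply: eq_trH => h; rewrite -[LHS]TS; congr (T _).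
rewrite /shift sw_antipode2; last by lin.
rewrite (@sw_map _ _ A H H (fun x => S (S x))); last by lin.
by apply: eq_sw => a b; rewrite !linearZ.
Qed.

End RegularCharacter.

(** * Algebraic integers of K and congruences modulo p *)

Section Congruence.
Variables (K : fieldType) (charK0 : [pchar K] =i pred0).

Definition algint (x : K) := integralOver (intr : int -> K) x.

Lemma algint_nat n : algint n%:R.
Proof. exact: integral_nat. Qed.

Lemma algintD x y : algint x -> algint y -> algint (x + y).
Proof. exact: integral_add. Qed.

Lemma algintM x y : algint x -> algint y -> algint (x * y).
Proof. exact: integral_mul. Qed.

Lemma algintX x n : algint x -> algint (x ^+ n).
Proof.
move=> ix; elim: n => [|n IH]; first exact: algint_nat 1.
by rewrite exprS; apply: algintM.
Qed.

Lemma algint_sum I r (P : pred I) (F : I -> K) :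
  (forall i, P i -> algint (F i)) -> algint (\sum_(i <- r | P i) F i).
Proof.
by move=> iF; apply: (big_ind algint) => //; [apply: algint_nat 0 | apply: algintD].
Qed.

(** The exponent k + 2 exceeds 1, so X^(k+2) - X is monic; its roots are 0 and the (k+1)-th roots of
    unity. *)
Lemma algint_unity_root k x : x ^+ k.+2 = x -> algint x.
Proof.
move=> xk; exists ('X^(k.+2) - 'X); last first.
  by rewrite rmorphB /= map_polyXn map_polyX /root !hornerE xk subrr.
rewrite monicE lead_coefDl ?lead_coefXn //.
by rewrite size_polyN size_polyX size_polyXn.
Qed.

Lemma freshman_pow p x y : prime p -> algint x -> algint y ->
  exists2 z, algint z & (x + y) ^+ p = x ^+ p + y ^+ p + p%:R * z.
Proof.
move=> pp ix iy; case: p pp => // p pp.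
(* The prime is p + 1 from here on; F i is the quotient by it of an inner binomial coefficient, an
   exact division. *)
pose F (i : nat) := ('C(p.+1, i.+1) %/ p.+1)%N.
exists (\sum_(i < p) (F i)%:R * (x ^+ (p - i) * y ^+ i.+1)).
  apply: algint_sum => i _; apply: algintM; first exact: algint_nat.
  by apply: algintM; apply: algintX.
rewrite exprDn big_ord_recl big_ord_recr /= subn0 expr0 mulr1 bin0 mulr1n.
rewrite /bump /= add1n subnn expr0 mul1r binn mulr1n -!addrA; congr (_ + _).
rewrite addrC; congr (_ + _); rewrite mulr_sumr; apply: eq_bigr => i _.
rewrite /bump /= add1n subSS mulrA -natrM mulnC divnK ?mulr_natl //.
by apply: prime_dvd_bin; rewrite ?ltnS ?ltn_ord.
Qed.

Lemma freshman_sum p n I (s : seq I) (r : I -> K) : prime p ->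
  (forall i, algint (r i)) ->
  exists2 z, algint z &
    (\sum_(i <- s) r i) ^+ (p ^ n) = \sum_(i <- s) r i ^+ (p ^ n) + p%:R * z.
Proof.
move=> pp ir; have p0 := prime_gt0 pp.
have one (f : I -> K) : (forall i, algint (f i)) -> exists2 z, algint z &
    (\sum_(i <- s) f i) ^+ p = \sum_(i <- s) f i ^+ p + p%:R * z.
  move=> jf; elim: s => [|i t [z iz E]].
    exists 0; first exact: algint_nat 0.
    by rewrite !big_nil expr0n eqn0Ngt p0 mulr0 addr0.
  have it : algint (\sum_(i <- t) f i) by apply: algint_sum.
  have [w iw E'] := freshman_pow pp (jf i) it.
  exists (z + w); first exact: algintD.
  by rewrite !big_cons E' E mulrDr !addrA.
elim: n => [|n [z iz E]].
  exists 0; first exact: algint_nat 0.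
  by rewrite mulr0 addr0 expr1; apply: eq_bigr => i _; rewrite expr1.
have [w iw E1] := one (fun i => r i ^+ (p ^ n)) (fun i => algintX _ (ir i)).
have ism : algint (\sum_(i <- s) r i ^+ (p ^ n)).
  by apply: algint_sum => i _; apply: algintX.
have ipz : algint (p%:R * z) by apply: algintM => //; apply: algint_nat.
have [v iv E2] := freshman_pow pp ism ipz.
(* Error terms of (\sum r^(p^n) + p z)^p: w from the sum, the middle one from (p z)^p, v from the
   mixed terms. *)
exists (w + z ^+ p * p%:R ^+ p.-1 + v).
  apply: algintD => //; apply: algintD => //; apply: algintM; first exact: algintX.
  by apply: algintX; apply: algint_nat.
have pX : p%:R ^+ p = p%:R * p%:R ^+ p.-1 :> K by rewrite -exprS prednK.
rewrite expnSr exprM E E2 E1 exprMn pX.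
under [in RHS]eq_bigr => i _ do rewrite exprM.
by rewrite !mulrDr -!addrA; congr (_ + (_ + _)); rewrite -mulrA (mulrC (z ^+ p)).
Qed.

Lemma natr_eq0_char0 n : (n%:R == 0 :> K) = (n == 0%N).
Proof.
case: n => [|n]; first by rewrite !eqxx.
by apply/negP => /(natf0_pchar (ltn0Sn n))[p]; rewrite charK0.
Qed.

(** Multiply the monic equation of w by p^d: since p w = 1, the integer \sum q_i p^(d-i) vanishes,
    so p divides its last term q_d = 1. *)
Lemma algint_inv_prime p w : prime p -> algint w -> 1 = p%:R * w -> False.
Proof.
move=> pp [q monq rq] E; set d := (size q).-1.
have sq : size q = d.+1 by rewrite /d prednK // lt0n size_poly_eq0 monic_neq0.
pose Z : int := \sum_(i < d.+1) q`_i * p%:Z ^+ (d - i).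
have Z0 : Z%:~R = 0 :> K.
  rewrite /Z rmorph_sum /=.
  transitivity (p%:R ^+ d * (map_poly (intr : int -> K) q).[w]); last first.
    by move/rootP: rq => ->; rewrite mulr0.
  rewrite (@horner_coef_wide _ (size q)); last exact: size_poly.
  rewrite sq mulr_sumr; apply: eq_bigr => i _.
  rewrite coef_map rmorphM /= rmorphXn /= mulrCA; congr (_ * _).
  have id : (i <= d)%N by rewrite -ltnS.
  have dE : p%:R ^+ d = p%:R ^+ (d - i) * p%:R ^+ i :> K by rewrite -exprD subnK.
  rewrite dE -mulrA -exprMn -E expr1n mulr1.
  by rewrite -pmulrn.
have {}Z0 : Z = 0.
  have : (`|Z|%N)%:R == 0 :> K.
    case: (Z) Z0 => n; first by rewrite -pmulrn => ->.
    by rewrite NegzE rmorphN /= -pmulrn => /eqP; rewrite oppr_eq0.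
  by rewrite natr_eq0_char0 absz_eq0 => /eqP.
have q1 : q`_d = 1 by move: monq; rewrite monicE lead_coefE -/d => /eqP.
have : (p%:Z %| q`_d)%Z.
  move: Z0; rewrite /Z big_ord_recr /= subnn expr0 mulr1 => /eqP.
  rewrite addrC addr_eq0 => /eqP ->; rewrite dvdzE abszN -dvdzE.
  apply: rpred_sum => i _; apply: dvdz_mull.
  by rewrite -(@prednK (d - i)) ?subn_gt0 ?ltn_ord // exprS dvdz_mulr.
by rewrite q1 dvdzE /= dvdn1 => /eqP p1; rewrite p1 in pp.
Qed.

End Congruence.

(** * Eigenvalues of matrices with M^(k+2) = M *)

Section Spectrum.
Variables (K : closedFieldType) (charK0 : [pchar K] =i pred0).

(** The minimal polynomial divides X^(k+2) - X, which splits and is separable in characteristic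
    zero. *)
Lemma diagonalizable_pow n (M : 'M[K]_n) k : M ^+ k.+2 = M -> diagonalizable M.
Proof.
case: n M => [|n] M Mk; first by rewrite (flatmx0 M); apply: diagonalizable0.
apply/diagonalizableP; pose P : {poly K} := 'X^(k.+2) - 'X.
have monP : P \is monic.
  rewrite monicE lead_coefDl ?lead_coefXn //.
  by rewrite size_polyN size_polyX size_polyXn.
have [r Pr] := closed_field_poly_normal P.
have {}Pr : P = \prod_(z <- r) ('X - z%:P).
  by rewrite {1}Pr (monicP monP) scale1r.
have sepP : separable_poly P.
  have k0 : k.+1%:R != 0 :> K by rewrite natr_eq0_char0.
  (* With q = k + 2, X P' - q P = (k + 1) X and q X^(k + 1) - P' = 1. *)
  rewrite unlock; apply/Bezout_coprimepP.
  exists (- (k.+2%:R * k.+1%:R^-1 * k.+2%:R) *: 'X^k,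
     (k.+2%:R * k.+1%:R^-1) *: 'X^(k.+1) - 1) => /=.
  rewrite (_ : _ + _ = 1) ?eqpxx //.
  rewrite /P derivB derivXn derivX -scaler_nat -!mul_polyC !exprS /=.
  rewrite polyCN !polyCM.
  have kV : k.+1%:R%:P * k.+1%:R^-1%:P = 1 :> {poly K} by rewrite -polyCM divff.
  have -> : k.+2%:R%:P = k.+1%:R%:P + 1 :> {poly K} by rewrite -addn1 natrD polyCD.
  move: kV; move: k.+1%:R%:P k.+1%:R^-1%:P ('X) ('X^k) => u v x y uv.

  ring: uv.
exists r; first by rewrite -separable_prod_XsubC -Pr.
rewrite -Pr; apply: mxminpoly_min.
by rewrite rmorphB /= rmorphXn /= horner_mx_X Mk subrr.
Qed.

Lemma trace_pow_eigenvalues n (M : 'M[K]_n) k : M ^+ k.+2 = M ->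
  exists2 r : 'I_n -> K, (forall i, algint (r i)) &
    forall j, \tr (M ^+ j) = \sum_i r i ^+ j.
Proof.
move=> Mk; have [P Pu /(diagonalizable_forLR Pu)[D MD]] := diagonalizable_pow Mk.
pose E := diag_mx D.
have {}MD : M = invmx P *m E *m P.
  rewrite MD.
  exact: conjVmx.
have powE j : M ^+ j = invmx P *m E ^+ j *m P.
  elim: j => [|j IH]; first by rewrite !expr0 mulmx1 mulVmx.
  by rewrite !exprSr IH [X in _ * X]MD -!mulmxE !mulmxA mulmxK //.
have powD j : E ^+ j = diag_mx (\row_i D 0 i ^+ j).
  elim: j => [|j IH].
    by apply/matrixP => a b; rewrite !mxE expr0.
  rewrite exprSr IH; apply/matrixP => a b; rewrite -mulmxE mul_diag_mx !mxE.
  by case: eqP => [->|_]; rewrite ?mulr1n ?mulr0n ?mulr0 // exprSr.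
exists (fun i => D 0 i) => [i|j].
  apply: (@algint_unity_root _ k).
  have : E ^+ k.+2 = E.
    have := powE k.+2; rewrite Mk {1}MD => /(congr1 (fun X => P *m X *m invmx P)).
    by rewrite -!mulmxA !mulmxV // !mulmx1 !mulmxA !mulmxV // !mul1mx.
  by rewrite powD => /matrixP/(_ i i); rewrite !mxE eqxx !mulr1n.
rewrite powE mxtrace_mulC mulmxA mulmxV // mul1mx powD mxtrace_diag.
by apply: eq_bigr => i _; rewrite mxE.
Qed.

End Spectrum.

(** * Operators on the (n+1)-th tensor power and the twisted cyclic shift *)

Section TensorPower.
Variables (K : fieldType) (N n d : nat).
Let J := {ffun 'I_n.+1 -> 'I_N}.
Hypothesis cardJ : #|{: J}| = d.+1.
Implicit Types (i j : 'I_n.+1) (M : 'I_n.+1 -> 'M[K]_N).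

(** Numbers the basis of the tensor power by ordinals; a dimension of the form d + 1 gives its
    matrices a ring structure. *)
Definition idx (a : 'I_d.+1) : J := enum_val (cast_ord (esym cardJ) a).

Lemma idx_bij : bijective idx.
Proof.
apply: bij_comp (enum_val_bij _) _.
by exists (cast_ord cardJ) => a; rewrite ?cast_ordK ?cast_ordKV.
Qed.

Lemma sum_idx (V : nmodType) (F : J -> V) :
  \sum_(a < d.+1) F (idx a) = \sum_c F c.
Proof. by rewrite [RHS](reindex idx) //; apply: onW_bij idx_bij. Qed.

(* The matrix of e_(a_0) ⊗ ... ⊗ e_(a_n) |-> e_(a_k) M_0 ⊗ ... ⊗ e_(a_(n+k)) M_n,
   indices being taken modulo n + 1. *)
Definition tmx k M : 'M[K]_d.+1 :=
  \matrix_(a, b) \prod_i M i (idx a (i + k)) (idx b i).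

Lemma eq_tmx k M M' : M =1 M' -> tmx k M = tmx k M'.
Proof.
by move=> E; apply/matrixP => a b; rewrite !mxE; under eq_bigr do rewrite E.
Qed.

(** The sum over intermediate indices factors slot by slot. Slot j of the second operator reads slot
    j + l, whence the shift in M. *)
Lemma tmxM (k l : 'I_n.+1) M M' :
  tmx k M * tmx l M' = tmx (k + l) (fun j => M (j + l) *m M' j).
Proof.
apply/matrixP => a b; rewrite [LHS]mxE [RHS]mxE.
under [LHS]eq_bigr => c _ do rewrite 2!mxE.
apply: etrans (sum_idx (fun c => (\prod_i M i (idx a (i + k)) (c i)) *
  (\prod_i M' i (c (i + l)) (idx b i)))) _.
transitivity (\sum_(c : J) \prod_i (M i (idx a (i + k)) (c i) *
    M' (i - l) (c i) (idx b (i - l)))).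
  apply: eq_bigr => c _; rewrite big_split /=; congr (_ * _).
  rewrite [RHS](reindex_inj (addIr l)); apply: eq_bigr => i _.
  by rewrite addrK.
rewrite -(bigA_distr_bigA (fun i x => M i (idx a (i + k)) x *
    M' (i - l) x (idx b (i - l)))).
rewrite [LHS](reindex_inj (addIr l)); apply: eq_bigr => i _.
rewrite !mxE; apply: eq_bigr => x _.
by rewrite addrK -addrA (addrC l).
Qed.

Lemma tmx1 M : (forall i, M i = 1%:M) -> tmx 0 M = 1.
Proof.
move=> M1; apply/matrixP => a b; rewrite !mxE.
have [->|ab] := eqVneq a b.
  by rewrite big1 // => i _; rewrite M1 mxE addr0 eqxx.
have [i nab] : exists i, idx a i != idx b i.
  apply/existsP; apply: contraNT ab; rewrite negb_exists => /forallP E.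
  apply/eqP/(bij_inj idx_bij)/ffunP => i.
  by have := E i; rewrite negbK => /eqP.
by rewrite (bigD1 i) //= M1 mxE addr0 (negPf nab) mul0r.
Qed.

Lemma trace_tmx0 M : \tr (tmx 0 M) = \prod_i \tr (M i).
Proof.
rewrite [LHS]/mxtrace; under [LHS]eq_bigr => a _ do rewrite mxE.
apply: etrans (sum_idx (fun c => \prod_i M i (c (i + 0)) (c i))) _.
rewrite (bigA_distr_bigA (fun i x => M i x x)).
by apply: eq_bigr => c _; apply: eq_bigr => i _; rewrite addr0.
Qed.

Definition slot i (X : 'M[K]_N) j := if j == i then X else 1%:M.

Lemma lin_slot i (V : lmodType K) (f : V -> 'M[K]_N) : is_lin f ->
  is_lin (fun x => tmx 0 (slot i (f x))).
Proof.
move=> lf a x y; apply/matrixP => u v.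
have E z : tmx 0 (slot i (f z)) u v = f z (idx u (i + 0)) (idx v i)
   * \prod_(j | j != i) (1%:M : 'M[K]_N) (idx u (j + 0)) (idx v j).
  rewrite mxE (bigD1 i) //= /slot eqxx; congr (_ * _).
  by apply: eq_bigr => j /negPf ->.
rewrite [RHS]mxE [X in _ = X + _]mxE !E lf [(_ + _ : 'M_N) _ _]mxE.
by rewrite [(a *: f x) _ _]mxE mulrDl mulrA.
Qed.

Lemma slotM i X Y : tmx 0 (slot i X) * tmx 0 (slot i Y) = tmx 0 (slot i (X *m Y)).
Proof.
rewrite tmxM addr0; apply: eq_tmx => j; rewrite addr0 /slot.
by case: ifP; rewrite ?mulmx1.
Qed.

Lemma slotC i j X Y : i != j ->
  tmx 0 (slot i X) * tmx 0 (slot j Y) = tmx 0 (slot j Y) * tmx 0 (slot i X).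
Proof.
move=> ij; rewrite !tmxM; apply: eq_tmx => k; rewrite addr0 /slot.
have [->|_] := eqVneq k i; first by rewrite (negPf ij) mulmx1 mul1mx.
by rewrite mulmx1 mul1mx.
Qed.

Definition cyc : 'I_n.+1 := inZp 1.

Lemma inord_cyc k : (k < n)%N -> inord k + cyc = inord k.+1.
Proof.
move=> kn; apply/val_inj; rewrite /= !inordK ?ltnS ?(ltnW kn) //.
by rewrite modnDmr addn1 modn_small.
Qed.

Lemma max_cyc : ord_max + cyc = ord0.
Proof. by apply/val_inj; rewrite /= modnDmr addn1 modnn. Qed.

Lemma cyc_case j : j = ord_max \/ exists2 k, (k < n)%N & j = inord k.
Proof.
have [jn|jn] := ltnP j n; first by right; exists j; rewrite ?inord_val.
by left; apply/val_inj/eqP; rewrite eqn_leq /= jn -ltnS ltn_ord.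
Qed.

Fixpoint rprod M k : 'M[K]_N :=
  if k is k'.+1 then M (inord k) *m rprod M k' else M ord0.

(* By cyclicity of the trace, the factor in one slot can be moved to the next
   one, so that all of them can be collected in the last slot. *)
Lemma trace_tmx_cyc M : \tr (tmx cyc M) = \tr (rprod M n).
Proof.
pose Q k j := if (j < k)%N then 1%:M else if j == k :> nat then rprod M k else M j.
have step k : (k <= n)%N -> \tr (tmx cyc M) = \tr (tmx cyc (Q k)).
  elim: k => [_|k IH kn].
    congr (\tr _); apply: eq_tmx => j; rewrite /Q ltn0.
    by case: eqP => // j0; congr M; apply: val_inj.
  rewrite {}IH ?(ltnW kn) //.
  pose B j := if (j == k :> nat) then 1%:M else Q k j.
  pose X := slot (inord k.+1) (rprod M k).
  have cj j : (j + cyc == inord k.+1) = (j == k :> nat).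
    rewrite -(inord_cyc kn) (inj_eq (addIr cyc)); apply/eqP/eqP => [->|jk].
      by rewrite inordK // ltnS ltnW.
    by apply: val_inj; rewrite /= inordK // ltnS ltnW.
  (* Slot k is fed by slot k + 1, so its factor can be applied there before the shift; exchanging
     the two operators under the trace puts it after M_(k+1). *)
  have -> : tmx cyc (Q k) = tmx 0 X * tmx cyc B.
    rewrite tmxM add0r; apply: eq_tmx => j; rewrite /X /slot /B /Q cj.
    by case: eqP => [->|_]; rewrite ?ltnn ?eqxx ?mulmx1 ?mul1mx.
  rewrite -mulmxE mxtrace_mulC mulmxE tmxM addr0; congr (\tr _).
  apply: eq_tmx => j; rewrite addr0 /B /X /slot /Q ltnS.
  have -> : (j == inord k.+1) = (j == k.+1 :> nat).
    by rewrite -val_eqE /= inordK.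
  have [jk1|jk1] := eqVneq (j : nat) k.+1.
    have kj : (k < j)%N by rewrite jk1.
    rewrite (gtn_eqF kj) ltnNge (ltnW kj) /= leqNgt kj /=.
    by congr (M _ *m _); apply/val_inj; rewrite /= jk1 inordK.
  rewrite mulmx1; have [jk|jk] := eqVneq (j : nat) k; first by rewrite jk leqnn.
  by rewrite [in RHS]leq_eqVlt (negPf jk).
(* All slots but the last now carry the identity, so only constant index functions contribute to the
   trace. *)
rewrite (step n) // /mxtrace; under [LHS]eq_bigr => a _ do rewrite mxE.
apply: etrans (sum_idx (fun c => \prod_i Q n i (c (i + cyc)) (c i))) _.
rewrite (partition_big (fun c : J => c ord0) xpredT) //=; apply: eq_bigr => x _.
pose cx : J := [ffun=> x].
rewrite (bigD1 cx) ?ffunE //= [X in _ + X]big1 ?addr0 => [|c /andP[/eqP c0 ncx]].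
  rewrite (bigD1 ord_max) //= big1 ?mulr1 => [|i ni].
    by rewrite !ffunE /Q ltnn eqxx.
  have lt_in : (i < n)%N by rewrite ltn_neqAle -ltnS ltn_ord andbT.
  by rewrite !ffunE /Q lt_in mxE eqxx.
apply/eqP; apply: contraNT ncx => nz; apply/eqP/ffunP => i; rewrite ffunE.
have {}nz j : Q n j (c (j + cyc)) (c j) != 0.
  by apply: contraNneq nz => z; rewrite (bigD1 j) //= z mul0r.
have cE k : (k <= n)%N -> c (inord k) = x.
  elim: k => [_|k IH kn].
    by rewrite -c0; congr (c _); apply/val_inj; rewrite /= inordK.
  have := nz (inord k); rewrite (inord_cyc kn) IH ?(ltnW kn) //.
  rewrite /Q inordK ?ltnS ?(ltnW kn) //.
  by rewrite kn mxE; case: (c (inord k.+1) =P x) => [-> //|_]; rewrite mulr0n eqxx.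
by rewrite -[i]inord_val cE // -ltnS.
Qed.

Section Twist.
Variable s : 'M[K]_N.
(* a_0 ⊗ ... ⊗ a_n |-> a_1 ⊗ ... ⊗ a_n ⊗ a_0 s *)
Definition twist : 'M[K]_d.+1 := tmx cyc (slot ord_max s).

(** The quotient counts how often the factor arriving in slot j has wrapped around, picking up s
    each time. *)
Lemma twist_pow k : twist ^+ k = tmx (cyc *+ k) (fun j => s ^+ ((j + k) %/ n.+1)).
Proof.
elim: k => [|k IH].
  rewrite expr0 mulr0n tmx1 // => j.
  by rewrite addn0 divn_small ?expr0.
rewrite exprSr IH tmxM mulrSr; apply: eq_tmx => j; rewrite /slot.
have [->|[i lt_in ->]] := cyc_case j.
  rewrite eqxx max_cyc /= add0n addnS -addSn addnC divnDr // divnn.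
  by rewrite addn1 exprSr mulmxE.
rewrite inord_cyc // -val_eqE /= !inordK ?ltnS ?(ltnW lt_in) // (ltn_eqF lt_in).
by rewrite mulmx1 addSnnS.
Qed.

Lemma twist_period : twist ^+ n.+1 = tmx 0 (fun _ => s).
Proof.
rewrite twist_pow (_ : cyc *+ n.+1 = 0); last first.
  by rewrite Zp_mulrn; apply/val_inj; rewrite /= modnMl.
apply: eq_tmx => j; rewrite divnDr // divnn divn_small ?ltn_ord //.
Qed.

Lemma twist_order k : s ^+ k = 1 -> twist ^+ (n.+1 * k) = 1.
Proof.
move=> sk; rewrite exprM twist_period -(@tmx1 (fun _ => s ^+ k)); last first.
  by move=> i; rewrite sk.
elim: k {sk} => [|k IH]; first by rewrite !expr0 tmx1.
by rewrite exprSr IH tmxM addr0; apply: eq_tmx => j; rewrite exprSr mulmxE.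
Qed.

End Twist.
End TensorPower.

(** * Convolution of algebra maps, and expansion into words *)

Section ConvHom.
Variables (K : fieldType) (H : falgType K) (A : hopf_algebra H).
Variable B : falgType K.
Implicit Types (h k a b c : H) (F G : nat -> H -> B) (s : seq nat).
Local Notation ε := (counit A).
Local Notation S := (antipode A).
Local Notation "'\sw_' ( a , b <- h ) E" := (sw A (fun a b => E) h).
Local Notation bas i := (vbasis {:H})`_i.

Lemma conv_intertwine F G (X : B) s h :
  (forall i, i \in s -> forall a, F i a * X = X * G i a) ->
  conv_seq A (map F s) h * X = X * conv_seq A (map G s) h.
Proof.
elim: s h => [|i s IH] h FG /=; first by rewrite -scalerAl -scalerAr mul1r mulr1.
rewrite (@sw_map _ _ A B B (fun y => y * X)); last by lin.
rewrite (@sw_map _ _ A B B (fun y => X * y)); last by lin.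
apply: eq_sw => a b; rewrite -mulrA IH => [|j js]; last first.
  by apply: FG; rewrite inE js orbT.
by rewrite !mulrA FG ?mem_head.
Qed.

(** As Δ is multiplicative, it only remains to move F_i(c) past the images under the other maps,
    with which it commutes. *)
Lemma conv_seq_hom F s h k : uniq s ->
  (forall i, is_lin (F i)) ->
  (forall i a b, F i (a * b) = F i a * F i b) ->
  (forall i j a b, i \in s -> j \in s -> i != j -> F i a * F j b = F j b * F i a) ->
  conv_seq A (map F s) (h * k) = conv_seq A (map F s) h * conv_seq A (map F s) k.
Proof.
have lc := @lin_conv_seq _ _ A B.
move=> + lF FM; elim: s h k => [|i s IH] h k /= => [_ _|/andP[is_ us] FC].
  by rewrite -scalerAl mul1r scalerA counitM.
have {}IH a b : conv_seq A [seq F i | i <- s] (a * b) =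
    conv_seq A [seq F i | i <- s] a * conv_seq A [seq F i | i <- s] b.
  by apply: IH => // j l c d js ls; apply: FC; rewrite inE ?js ?ls orbT.
rewrite swM; last by lin.
rewrite (@sw_map _ _ A B B (fun y => y * _)); last by lin.
apply: eq_sw => a b.
rewrite (@sw_map _ _ A B B (fun y =>
  F i a * conv_seq A [seq F i | i <- s] b * y)); last by lin.
apply: eq_sw => c d; rewrite FM IH !mulrA; congr (_ * _); rewrite -!mulrA.
congr (_ * _); apply/esym/conv_intertwine => j js x; apply: FC.
- by rewrite inE js orbT.
- exact: mem_head.
- by apply: contraNneq is_ => <-.
Qed.

(* Weighted words w.1 *: w.2 whose sum is the n-fold coproduct of h. *)
Fixpoint comul_words n h : seq (K * seq H) :=
  if n is n'.+1 then
    flatten [seq [seq (w.1, bas i :: w.2) |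
        w <- comul_words n' (\sum_j (comul A h : 'M[K]_(_, _)) i j *: bas j)] |
      i : 'I_(\dim {:H}) <- enum 'I_(\dim {:H})]
  else [:: (ε h, [::])].

End ConvHom.

(** The words depend only on h and the number of maps, so convolution products in different algebras
    can be compared term by term. *)
Lemma conv_seq_words (K : fieldType) (H : falgType K) (A : hopf_algebra H)
    (B : falgType K) (fs : seq (H -> B)) h :
  conv_seq A fs h = \sum_(w <- comul_words A (size fs) h)
    w.1 *: \prod_(i < size fs) (nth (fun _ => 0) fs i) (nth 0 w.2 i).
Proof.
elim: fs h => [|f fs IH] h /=; first by rewrite big_seq1 big_ord0.
rewrite big_flatten big_map big_enum /=; apply: eq_bigr => i _.
rewrite big_map; under [RHS]eq_bigr => w _ do rewrite big_ord_recl /=.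
transitivity (f (vbasis {:H})`_i * conv_seq A fs
    (\sum_j (comul A h : 'M[K]_(_, _)) i j *: (vbasis {:H})`_j)).
  rewrite (is_lin_sum (@lin_conv_seq _ _ A B fs)) mulr_sumr.
  by apply: eq_bigr => j _; rewrite (is_linZ (@lin_conv_seq _ _ A B fs)) scalerAr.
rewrite IH mulr_sumr; apply: eq_bigr => w _.
by rewrite -scalerAr.
Qed.

(** * Matrices of right multiplications and of S² *)

Section Matrices.
Variables (K : fieldType) (H : falgType K) (A : hopf_algebra H).
Implicit Types (h a b c : H).
Local Notation ε := (counit A).
Local Notation S := (antipode A).
Local Notation bas i := (vbasis {:H})`_i.
Local Notation N := (\dim {:H}).
Local Notation lam := (lam A).

Definition mat (F : H -> H) : 'M[K]_N := \matrix_(i, j) crd j (F (bas i)).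

Lemma mat_comp (F G : H -> H) : is_lin G ->
  mat (fun x => G (F x)) = mat F *m mat G.
Proof.
move=> lG; apply/matrixP => i j; rewrite !mxE; have lc := @lin_crd K H j.
rewrite -(@crd_lin _ _ K^o (fun x => crd j (G x))); last by lin.
by apply: eq_bigr => k _; rewrite !mxE.
Qed.

Lemma mat_id : mat id = 1%:M.
Proof. by apply/matrixP => i j; rewrite !mxE crd_bas eq_sym. Qed.

Lemma eq_mat F G : F =1 G -> mat F = mat G.
Proof. by move=> E; apply/matrixP => i j; rewrite !mxE E. Qed.

Lemma trace_mat F : \tr (mat F) = trH F.
Proof. by apply: eq_bigr => i _; rewrite mxE. Qed.

Lemma mat_iter (F : H -> H) k : is_lin F -> mat F ^+ k = mat (iter k F).
Proof.
move=> lF; elim: k => [|k IH]; first exact: (esym mat_id).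
by rewrite exprSr IH -mulmxE -mat_comp.
Qed.

(* Matrices act on row vectors, so right multiplication is multiplicative. *)
Definition rho h := mat (fun x => x * h).

Lemma lin_rho : is_lin rho.
Proof.
move=> a x y; apply/matrixP => i j; rewrite !mxE mulrDr -scalerAr.
exact: (lin_crd j).
Qed.

Lemma rhoM h (k : H) : rho (h * k) = rho h *m rho k.
Proof.
by rewrite -mat_comp; [apply: eq_mat => x; rewrite mulrA | lin].
Qed.

Definition antip2 := mat (fun x => S (S x)).

Lemma rho_antip2 h : rho h *m antip2 = antip2 *m rho (S (S h)).
Proof.
rewrite -!mat_comp; try lin.
by apply: eq_mat => x; rewrite antipode2M.
Qed.

Lemma trace_rho_antip2 h : \tr (rho h *m antip2) = lam (S h).
Proof. by rewrite lam_antipode -mat_comp ?trace_mat //; lin. Qed.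

Lemma antip2_order e : sweedler_trivial A e ->
  forall L, two_sided_integral A L -> ε L = 1 -> antip2 ^+ (2 * e) = 1.
Proof.
move=> triv L iL eL; rewrite mat_iter; last by lin.
rewrite -[RHS]/(1%:M) -mat_id; apply: eq_mat => x.
rewrite -[RHS](antipode_order iL eL x triv) -[4%N]/(2 * 2)%N -mulnA.
elim: (2 * e)%N => [|k IH]; first by rewrite muln0.
by rewrite mulnS iterS IH.
Qed.

(** An integral φ of the dual satisfies φ * φ = φ(1) φ under convolution; here φ = lam o S, and S(1)
    = 1. *)
Lemma conv_mu n h :
  conv_seq A (nseq n.+1 (fun x => lam (S x))) h = lam 1 ^+ n *: lam (S h) :> K^o.
Proof.
have ll := @lin_lam _ _ A; elim: n h => [|n IH] h.
  rewrite /= scale1r -[RHS](@sw_counitr _ _ A K^o (fun x => lam (S x)));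
    last by lin.
  by apply: eq_sw => a b; rewrite /GRing.scale /= mulr1 mulrC.
transitivity (sw A (fun a b => (lam (S a) : K^o) *
    conv_seq A (nseq n.+1 (fun x => lam (S x))) b) h); first by [].
under eq_sw => a b do rewrite IH.
transitivity (lam 1 ^+ n *: sw A (fun a b => lam (S a) *: lam (S b)) h).
  rewrite (@sw_map _ _ A K^o K^o ( *:%R (lam 1 ^+ n))); last by lin.
  by apply: eq_sw => a b; rewrite /GRing.scale /= mulrCA.
rewrite (@mu_int _ _ A K^o lam) // exprSr /GRing.scale /= -mulrA.
by rewrite (mulrC (lam 1)).
Qed.

(** * The operator T and its absorption property *)

Section Operator.
Variables (n d : nat) (cardJ : #|{: {ffun 'I_n.+1 -> 'I_N}}| = d.+1).
Hypothesis n_gt0 : (0 < n)%N.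
Local Notation "'\sw_' ( a , b <- h ) E" := (sw A (fun a b => E) h).

Definition act (i : nat) h : 'M[K]_d.+1 := tmx cardJ 0 (slot (inord i) (rho h)).
Local Notation C := (twist cardJ antip2).

Lemma lin_act i : is_lin (act i).
Proof. exact: (lin_slot cardJ (inord i) lin_rho). Qed.

Lemma actM i h (k : H) : act i (h * k) = act i h * act i k.
Proof. by rewrite /act slotM rhoM. Qed.

Lemma actC i j h (k : H) : (i <= n)%N -> (j <= n)%N -> i != j ->
  act i h * act j k = act j k * act i h.
Proof.
move=> i_le j_le ij; apply: slotC.
by rewrite -val_eqE /= !inordK.
Qed.

Lemma act_twist i h : (i < n)%N -> act i.+1 h * C = C * act i h.
Proof.
move=> lt_in; rewrite /act /twist !tmxM addr0 add0r; apply: eq_tmx => j.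
rewrite addr0 /slot -inord_cyc // (inj_eq (addIr _)).
have [->|_] := eqVneq j (inord i); last by rewrite mul1mx mulmx1.
rewrite -val_eqE /= inordK ?ltnS 1?ltnW // (ltn_eqF lt_in).
by rewrite mul1mx mulmx1.
Qed.

Lemma act_twist0 h : act 0 h * C = C * act n (S (S h)).
Proof.
rewrite /act /twist !tmxM addr0 add0r; apply: eq_tmx => j.
have -> : inord n = ord_max :> 'I_n.+1 by apply/val_inj; rewrite /= inordK.
have -> : inord 0 = ord_max + cyc n.
  by rewrite max_cyc; apply/val_inj; rewrite /= inordK.
rewrite addr0 /slot (inj_eq (addIr _)).
by case: eqP; rewrite ?mul1mx // rho_antip2.
Qed.

(** Right multiplication by the (n+1)-fold coproduct of h, written as a convolution of the commuting
    slot actions; Z below is its analogue on slots 0 to n - 1. *)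
Definition diag_act h := conv_seq A (map act (iota 0 n.+1)) h.
Local Notation Z := (fun h => conv_seq A (map act (iota 0 n)) h).

Lemma diag_act_words h : diag_act h = \sum_(w <- comul_words A n.+1 h)
  w.1 *: tmx cardJ 0 (fun j => rho (nth 0 w.2 j)).
Proof.
rewrite /diag_act conv_seq_words size_map size_iota; apply: eq_bigr => w _.
congr (_ *: _).
have E k : (k <= n.+1)%N -> \prod_(i < k) act i (nth 0 w.2 i)
    = tmx cardJ 0 (fun j => if (j < k)%N then rho (nth 0 w.2 j) else 1%:M).
  elim: k => [_|k IH kn]; first by rewrite big_ord0 tmx1.
  rewrite big_ord_recr /= IH ?(ltnW kn) // /act tmxM addr0.
  apply: eq_tmx => j; rewrite addr0 /slot -val_eqE /= inordK // ltnS.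
  have [->|jk] := eqVneq (j : nat) k; first by rewrite ltnn leqnn mul1mx.
  by rewrite mulmx1 [in RHS]leq_eqVlt (negPf jk).
transitivity (\prod_(i < n.+1) act i (nth 0 w.2 i)).
  apply: eq_bigr => i _.
  by rewrite (nth_map 0%N) ?size_iota // nth_iota // add0n.
by rewrite E //; apply: eq_tmx => j; rewrite ltn_ord.
Qed.

Lemma diag_act_last h : diag_act h = \sw_(a, b <- h) (Z a * act n b).
Proof.
have la := lin_act.
have E : iota 0 n.+1 = iota 0 n ++ [:: n] by rewrite -(addn1 n) iotaD.
rewrite /diag_act E map_cat conv_seq_cat => [|i]; last first.
  have [lt_in|ge_in] := ltnP i n.
    by rewrite (nth_map 0%N) ?size_iota //; apply: la.
  rewrite nth_default ?size_map ?size_iota // => a x y.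
  by rewrite addr0 scaler0.
apply: eq_sw => a b; congr (_ * _) => /=.
under eq_sw => c g do rewrite -scalerAr mulr1.
by rewrite sw_counitr //; apply: la.
Qed.

Lemma ZC h : conv_seq A (map act (iota 1 n)) h * C = C * Z h.
Proof.
rewrite (iotaDl 1 0 n) -map_comp; apply: conv_intertwine => i.
by rewrite mem_iota add0n => /andP[_ lt_in] a; apply: act_twist.
Qed.

Lemma Z_act h (k : H) : Z h * act n k = act n k * Z h.
Proof.
apply: conv_intertwine => i; rewrite mem_iota add0n => /andP[_ lt_in] a.
by apply: actC; rewrite ?(ltnW lt_in) // neq_ltn lt_in.
Qed.

Lemma ZM h (k : H) : Z (h * k) = Z h * Z k.
Proof.
apply: conv_seq_hom; [exact: iota_uniq|exact: lin_act|exact: actM|].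
move=> i j a b; rewrite !mem_iota !add0n => /andP[_ i_lt] /andP[_ j_lt].
by apply: actC; apply: ltnW.
Qed.

Variable L : H.
Hypothesis intL : two_sided_integral A L.
Hypothesis epsL : ε L = 1.

Definition rot_op := diag_act L * C.

Lemma rot_opE : rot_op = \sw_(x, y <- L) (C * (Z y * act n (S (S x)))).
Proof.
rewrite /rot_op /diag_act /= (@sw_map _ _ A _ _ (fun X => X * C)); last by lin.
apply: eq_sw => x y; rewrite -mulrA ZC mulrA act_twist0 -mulrA.
by rewrite Z_act.
Qed.

(** Behind the shift, L_(2) acts on the first n slots and S²(L_(1)) on the last. Multiplying by
    S²(h) gives S²(L_(1) h_(2)) and L_(2) S²(h_(1)); [integral_right] moves h_(2) over, leaving
    L_(2) S(S(h_(1)) h_(2)) = ε(h) L_(2). *)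
Lemma rot_op_diag h : rot_op * diag_act (S (S h)) = ε h *: rot_op.
Proof.
have la := lin_act n; have lZ : is_lin Z by apply: lin_conv_seq.
pose F u v : 'M[K]_d.+1 := C * (Z v * act n u).
have bF : is_bil F.
  split=> [v|u]; rewrite /F.
    exact: (lin_mulr _ (lin_mulr _ la)).
  exact: (lin_mulr _ (lin_mull _ lZ)).
have Fdiag u v (k : H) : F u v * diag_act k = \sw_(a, b <- k) F (u * b) (v * a).
  rewrite diag_act_last (@sw_map _ _ A _ _ (fun X => F u v * X)); last by lin.
  apply: eq_sw => a b; rewrite /F ZM actM -!mulrA; congr (_ * (_ * _)).
  by rewrite !mulrA Z_act.
rewrite rot_opE -/F (@sw_map _ _ A _ _ (fun X => X * diag_act (S (S h))));
  last by lin.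
transitivity (\sw_(x, y <- L) \sw_(a, b <- h) F (S (S (x * b))) (y * S (S a))).
  apply: eq_sw => x y; rewrite -/(F _ _) Fdiag sw_antipode2; last by lin.
  by apply: eq_sw => a b; rewrite antipode2M.
rewrite sw_swap.
under eq_sw => a b do [rewrite (@integral_right _ _ _ _ intL _
  (fun x y => F (S (S x)) (y * S (S a)))); last by lin].
rewrite sw_swap (@sw_map _ _ A _ _ ( *:%R (ε h))); last by lin.
apply: eq_sw => x y.
transitivity (\sw_(a, b <- h) F (S (S x)) (y * S (S a * b))).
  by apply: eq_sw => a b; rewrite antipodeM mulrA.
rewrite (@sw_antipodel _ _ A _ (fun z => F (S (S x)) (y * S z))); last by lin.
by rewrite antipode1 mulr1.
Qed.

End Operator.
End Matrices.

(** * The traces of T and of its (n+1)-th power *)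

Section OperatorTraces.
Variables (K : fieldType) (H : falgType K) (A : hopf_algebra H).
Variables (n d : nat) (cardJ : #|{: {ffun 'I_n.+1 -> 'I_(\dim {:H})}}| = d.+1).
Hypothesis n_gt0 : (0 < n)%N.
Variable L : H.
Hypothesis intL : two_sided_integral A L.
Hypothesis epsL : counit A L = 1.
Variable e : nat.
Hypothesis e_gt0 : (0 < e)%N.
Hypothesis triv : sweedler_trivial A e.
Local Notation S := (antipode A).
Local Notation lam := (lam A).
Local Notation C := (twist cardJ (antip2 A)).
Local Notation P := (diag_act A cardJ L).
Local Notation T := (rot_op A cardJ L).
Implicit Types (h a b : H).

(** [rot_op_diag] is applied to the preimage S^(4e-2)(L) of L under S², available because S^(4e) =
    id. *)
Lemma rot_op_proj : T * P = T.
Proof.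
pose k := iter (4 * e - 2) S L.
have eps_k : counit A k = 1.
  rewrite /k; elim: (_ - _)%N => //= j IH; by rewrite counit_antipode.
have Lk : L = S (S k).
  rewrite /k -!iterS -(addn2 (_ - _)) subnK ?(antipode_order intL epsL) //.
  by rewrite (leq_trans (n := 4)) // leq_pmulr.
by rewrite {2}Lk rot_op_diag // eps_k scale1r.
Qed.

(** T P = T lets every inner factor P be absorbed, so powers of T reduce to powers of the twist
    C. *)
Lemma rot_op_pow k : T ^+ k.+1 = P * C ^+ k.+1.
Proof.
have E j : P * C ^+ j.+1 * P = P * C ^+ j.+1.
  elim: j => [|j IH]; first exact: rot_op_proj.
  rewrite [C ^+ j.+2]exprSr mulrA -IH -!(mulrA (P * C ^+ j.+1)).
  by rewrite rot_op_proj.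
elim: k => [//|k IH]; rewrite exprSr IH /rot_op mulrA E.
by rewrite -mulrA -exprSr.
Qed.

Lemma rot_op_period : T ^+ (n.+1 * (2 * e)).+1 = T.
Proof.
rewrite rot_op_pow exprSr twist_order ?mul1r //.
exact: (antip2_order triv intL epsL).
Qed.

(** The (n+1)-th power of C is S² in every slot, so the trace factors into the values lam(S(L_(i))),
    a convolution power evaluated by [conv_mu]. *)
Lemma trace_rot_op_full : \tr (T ^+ n.+1) = lam 1 ^+ n.
Proof.
rewrite rot_op_pow twist_period diag_act_words mulr_suml linear_sum /=.
transitivity (conv_seq A (nseq n.+1 (fun x => lam (S x) : K^o)) L).
  rewrite conv_seq_words size_nseq; apply: eq_bigr => w _.
  rewrite -scalerAl linearZ /= tmxM addr0 trace_tmx0; congr (_ * _).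
  apply: eq_bigr => j _; rewrite (nth_nseq _ n.+1) ltn_ord addr0.
  exact: trace_rho_antip2.
by rewrite conv_mu lam_antipodeL // /GRing.scale /= mulr1.
Qed.

(** The cyclic trace collapses to one trace on H, giving lam of the (n+1)-th convolution power of S
    at L; as n is a multiple of e, this is lam(S(L)). *)
Lemma trace_rot_op q : n = (q * e)%N -> \tr T = 1.
Proof.
move=> nq; rewrite /rot_op diag_act_words mulr_suml linear_sum /=.
have ll := @lin_lam _ _ A.
transitivity (lam (conv_seq A (nseq n.+1 (S : H -> H)) L)); last first.
  rewrite -[X in lam X]/(conv_pow A S n.+1 L) -addn1 nq conv_pow_antipode_exp //.
  exact: lam_antipodeL.
rewrite conv_seq_words size_nseq (is_lin_sum ll); apply: eq_bigr => w _.
rewrite (is_linZ ll) -scalerAl linearZ /= tmxM add0r; congr (_ * _).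
pose X i := nth 0 w.2 i.
rewrite trace_tmx_cyc; set M := fun j : 'I_n.+1 => _.
have MS k : (k < n)%N -> M (inord k) = rho (X k.+1).
  move=> lt_kn; rewrite /M inord_cyc // /slot -val_eqE /= !inordK //;
    last exact: ltnW.
  by rewrite (ltn_eqF lt_kn) mulmx1.
have Mn : M (inord n) = rho (X 0%N) *m antip2 A.
  have -> : inord n = ord_max :> 'I_n.+1 by apply/val_inj; rewrite /= inordK.
  by rewrite /M max_cyc /slot eqxx.
(* Y k is X_(k+1) ... X_1. The factor X_0, which reaches the last slot together with S², is joined
   on the right by cyclicity, and S reverses the order. *)
pose Y := fix Y k := if k is k'.+1 then X k.+1 * Y k' else X 1%N.
have rprodY k : (k < n)%N -> rprod M k = rho (Y k).
  elim: k => [|k IH] lt_kn /=.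
    by rewrite -MS //; congr M; apply/val_inj; rewrite /= inordK.
  by rewrite MS // IH ?(ltnW lt_kn) // -rhoM.
have YS k : S (Y k * X 0%N) = \prod_(i < k.+2) S (X i).
  elim: k => [|k IH]; first by rewrite antipodeM big_ord_recr big_ord1.
  by rewrite /= -mulrA antipodeM IH [RHS]big_ord_recr.
have rprodS k : (0 < k)%N -> rprod M k = M (inord k) *m rprod M k.-1 by case: k.
rewrite rprodS // Mn rprodY ?prednK // mxtrace_mulC mulmxA -rhoM trace_rho_antip2.
rewrite YS prednK //; congr lam; apply: eq_bigr => j _.
by rewrite (nth_nseq _ n.+1) ltn_ord.
Qed.

End OperatorTraces.

(** * Divisibility of tr S² by dim H, and the final congruence *)

Section DivisibilityOfTrace.
Variables (K : closedFieldType) (charK0 : [pchar K] =i pred0).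
Variables (H : falgType K) (A : hopf_algebra H).
Local Notation S := (antipode A).
Local Notation lam := (lam A).

Lemma dim_neq0 : (\dim {:H})%:R != 0 :> K.
Proof.
rewrite natr_eq0_char0 // dimv_eq0; apply/eqP => H0.
by have := memvf (1 : H); rewrite H0 memv0 oner_eq0.
Qed.

Lemma trace_antip2_dvd L e : two_sided_integral A L -> counit A L = 1 ->
  (0 < e)%N -> sweedler_trivial A e ->
  exists2 t, algint t & lam 1 = (\dim {:H})%:R * t.
Proof.
move=> iL eL e_gt0 triv; have N0 := dim_neq0.
pose x : H := (\dim {:H})%:R^-1 *: dual_reg A.
have xx : x * x = x.
  rewrite /x -scalerAl -scalerAr dual_reg_sqr !scalerA; congr (_ *: _).
  by rewrite -mulrA mulVf ?mulr1.
pose U := iter (4 * e - 2) S.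
have lU : is_lin U.
  rewrite /U; elim: (_ - _)%N => [//|j IH].
  exact: (lin_comp (lin_struct S) IH).
have e4 : (4 * e = (4 * e - 2).+2)%N.
  by rewrite -(addn2 (4 * e - 2)%N) subnK // (leq_trans (n := 4)) // leq_pmulr.
have SU h : S (S (U h)) = h.
  by rewrite /U -!iterS -e4 (antipode_order iL eL).
have US h : U (S (S h)) = h.
  by rewrite /U -!iterSr -e4 (antipode_order iL eL).
have Sx : S (S x) = x by rewrite /x !linearZ /= (antipode2_dual_reg lU US SU).
pose l := mat (fun y => x * y); pose s := antip2 A.
have ls : l *m s = s *m l.
  rewrite -!mat_comp; try lin.
  by apply: eq_mat => y; rewrite antipode2M Sx.
have ll : l *m l = l.
  by rewrite -mat_comp; [apply: eq_mat => y; rewrite mulrA xx | lin].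
have se : s ^+ (2 * e) = 1 := antip2_order triv iL eL.
have [k Ek] : exists k, (2 * e = k.+1)%N.
  by exists (2 * e).-1; rewrite prednK // muln_gt0.
have slX j : (s *m l) ^+ j.+1 = s ^+ j.+1 *m l.
  elim: j => [|j IH]; first by rewrite !expr1.
  rewrite exprSr IH -mulmxE mulmxA -[s ^+ j.+1 *m l *m s]mulmxA ls.
  by rewrite -!mulmxA ll !mulmxA mulmxE -exprSr.
have /(trace_pow_eigenvalues charK0)[r ir tr] : (s *m l) ^+ k.+2 = s *m l.
  by rewrite slX exprSr -Ek se mul1r.
exists (\tr (s *m l)).
  rewrite -[s *m l]expr1 tr; apply: algint_sum => i _.
  by rewrite expr1.
(* In row-vector order s *m l is the operator y |-> x S²(y), whose trace defines lam(x). *)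
have -> : \tr (s *m l) = lam x by rewrite -mat_comp ?trace_mat //; lin.
have ilam := @lin_lam _ _ A.
by rewrite /x (is_linZ ilam) lam_dual_reg /GRing.scale /= mulrA divff ?mul1r.
Qed.

Lemma prime_dvd_exponent L e p : two_sided_integral A L -> counit A L = 1 ->
  (0 < e)%N -> sweedler_trivial A e -> prime p ->
  (p %| \dim {:H})%N -> (p %| e)%N.
Proof.
move=> iL eL e_gt0 triv pp /dvdnP[c Nc]; apply: contraT => npe.
have cpe : coprime p e by rewrite prime_coprime.
(* By Euler's theorem this power of p is 1 modulo e, so n = m - 1 is a positive multiple of e. *)
pose m := (p ^ totient e)%N; pose n := m.-1.
have m_gt1 : (1 < m)%N.
  by rewrite -(exp1n (totient e)) ltn_exp2r ?totient_gt0 // prime_gt1.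
have mE : m = n.+1 by rewrite /n prednK // ltnW.
have n_gt0 : (0 < n)%N by rewrite -ltnS -mE.
have [q nq] : exists q, n = (q * e)%N.
  apply/dvdnP; rewrite /n -subn1 -eqn_mod_dvd ?(ltnW m_gt1) //.
  by apply/eqP; apply: Euler_exp_totient.
have N_gt0 : (0 < \dim {:H})%N.
  by rewrite lt0n; apply: contraNneq dim_neq0 => ->.
have [d cardJ] : exists d, #|{: {ffun 'I_n.+1 -> 'I_(\dim {:H})}}| = d.+1.
  exists #|{: {ffun 'I_n.+1 -> 'I_(\dim {:H})}}|.-1.
  by rewrite prednK // card_ffun !card_ord expn_gt0 N_gt0.
pose T := rot_op A cardJ L.
have [k Ek] : exists k, (n.+1 * (2 * e) = k.+1)%N.
  by exists (n.+1 * (2 * e)).-1; rewrite prednK // !muln_gt0.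
have [|r ir tr] := @trace_pow_eigenvalues _ charK0 _ T k.
  by rewrite -Ek (rot_op_period cardJ iL eL e_gt0 triv).
have T1 : \tr T = 1 by apply: (trace_rot_op cardJ n_gt0 iL eL triv nq).
have Tm : \tr (T ^+ n.+1) = lam 1 ^+ n.
  exact: (trace_rot_op_full cardJ iL eL e_gt0 triv).
have [z iz Ez] := freshman_sum (totient e) (index_enum _) pp ir.
have [t it Et] := trace_antip2_dvd iL eL e_gt0 triv.
have E1 : \sum_i r i = 1.
  by rewrite -T1 -[T]expr1 tr; apply: eq_bigr => i _; rewrite expr1.
have Em : \sum_i r i ^+ (p ^ totient e) = lam 1 ^+ n.
  by rewrite -Tm tr -mE.
(* With dim H = c p and lam(1) = c p t, the trace lam(1)^n is p times c t lam(1)^(n-1), since n > 0;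
   z is the error of the Frobenius congruence. *)
exfalso; apply: (@algint_inv_prime _ charK0 p (c%:R * t * lam 1 ^+ n.-1 + z)) => //.
  apply: algintD iz; apply: algintM.
    by apply: algintM it; apply: algint_nat.
  by apply: algintX; rewrite Et; apply: algintM it; apply: algint_nat.
move: Ez; rewrite E1 Em expr1n => {1}->; rewrite mulrDr; congr (_ + _).
rewrite -[in LHS](prednK n_gt0) exprS {1}Et Nc natrM.
by rewrite mulrA; congr (_ * _); rewrite mulrA (mulrC p%:R).
Qed.

End DivisibilityOfTrace.

Local Close Scope ring_scope.

Theorem theorem3p4 (K : closedFieldType) (charK0 : [pchar K]%R =i pred0)
    (H : falgType K) (A : hopf_algebra H) (ssH : semisimple_algebra H)
    (e : nat) (expH : is_hopf_exponent A e)
    (p : nat) (p_prime : prime p) (p_dvd_dim : p %| \dim (fullv : {vspace H})) :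
  p %| e.
Proof.
have [L [intL epsL]] := semisimple_integral A ssH.
have [e_gt0 triv _] := expH.
exact: (prime_dvd_exponent charK0 intL epsL e_gt0 triv).
Qed.
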